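(* Let $R$, $q$, $h$, $f_{i,j,k}$, $\widetilde S$, $\widetilde T$ and the action of $SL_3(\mathbb{Q})$ on $R$ be as defined in the context (base field $\mathbb{Q}$), and put \[ H=h-\tfrac 13f_{2,1,0}f_{0,1,2}-\tfrac 13f_{2,0,1}f_{0,2,1}+\tfrac 23 f_{1,2,0}f_{1,0,2}+\tfrac 1{12}f_{1,1,1}^2, \] \begin{align*} Q={}& q-\tfrac 12 h f_{1,1,1}+\tfrac 32f_{3,0,0}f_{0,3,0}f_{0,0,3}\\ & -\tfrac 12f_{3,0,0}f_{0,2,1}f_{0,1,2}-\tfrac 12 f_{0,3,0}f_{2,0,1}f_{1,0,2}-\tfrac 12 f_{0,0,3}f_{2,1,0}f_{1,2,0}\\ & -\tfrac 12f_{1,1,1}f_{1,2,0}f_{1,0,2}+\tfrac 12f_{2,1,0}f_{1,0,2}f_{0,2,1}+\tfrac 12f_{1,2,0}f_{2,0,1}f_{0,1,2}. \end{align*} Then \[ Q^2=H^3+27H\widetilde{S}-\frac{27}{4}\widetilde{T}. \] Moreover, $H$ and $Q$ are characterized, up to non-zero scalar multiples, as the unique $SL_3(\mathbb{Q})$-invariants in $R$ that are homogeneous of degree $6$ and of degree $9$, respectively (that is, the space of homogeneous degree $6$ elements of $R^{SL_3(\mathbb{Q})}$ is one-dimensional and spanned by $H$, and the space of homogeneous degree $9$ elements of $R^{SL_3(\mathbb{Q})}$ is one-dimensional and spanned by $Q$).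
   Context: $M_3(\mathbb{Q})^3$ is the space of triples $(A_1,A_2,A_3)$ of $3\times 3$ rational matrices. The group $SL_3(\mathbb{Q})\times SL_3(\mathbb{Q})$ acts on it by $(g,g')\cdot(A_1,A_2,A_3)=(gA_1g'^{-1},gA_2g'^{-1},gA_3g'^{-1})$, and $R=\mathbb{Q}[M_3(\mathbb{Q})^3]^{SL_3(\mathbb{Q})\times SL_3(\mathbb{Q})}$ is the algebra of invariant polynomial functions, graded by the total degree in the $27$ matrix entries. The elements $f_{i,j,k}\in R$ ($i+j+k=3$, $i,j,k\ge 0$) are defined by \[ \det(t_1A_1+t_2A_2+t_3A_3)=\sum_{i+j+k=3}t_1^it_2^jt_3^kf_{i,j,k}(A_1,A_2,A_3). \] $h\in R$ is the coefficient of $t_1^2t_2^2t_3^2$ in $\det\left(\begin{array}{cc}t_2A_2 & t_1A_1 \\t_1A_1 & t_3A_3\end{array}\right)$ (a $6\times 6$ determinant). $q\in R$ is the coefficient of $t_1^2t_2t_3^2t_4t_5^2t_6$ in $\det\left(\begin{array}{ccc}0 & t_1A_1 & t_2A_2 \\t_4A_1 & 0 & t_3A_3 \\t_5A_2 & t_6A_3 & 0\end{array}\right)$ (a $9\times 9$ determinant). A second action: $GL_3(\mathbb{Q})$ acts on $M_3(\mathbb{Q})^3$ from the right by \[ (A_1,A_2,A_3)\cdot g=\left(\sum_{i=1}^3g_{i1}A_i,\ \sum_{i=1}^3g_{i2}A_i,\ \sum_{i=1}^3g_{i3}A_i\right),\qquad g=(g_{ij}), \] and hence on polynomial functions from the left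 by $(g\cdot f)(A_1,A_2,A_3)=f((A_1,A_2,A_3)\cdot g)$. This action commutes with the first one, so it preserves $R$. ''$SL_3(\mathbb{Q})$-invariants in $R$'', and $R^{SL_3(\mathbb{Q})}$, refer to the restriction of this second action to $SL_3(\mathbb{Q})$. Aronhold invariants: write the general ternary cubic form as \[ aX^3+bY^3+cZ^3+3a_2X^2Y+3a_3X^2Z+3b_1XY^2+3b_3Y^2Z+3c_1XZ^2+3c_2YZ^2+6mXYZ. \] The algebra of polynomials in the ten coefficients $a,b,c,a_2,a_3,b_1,b_3,c_1,c_2,m$ that are invariant under all linear substitutions of the variables $X,Y,Z$ of determinant $1$ is generated by two algebraically independent homogeneous elements $S$ (degree $4$) and $T$ (degree $6$), each unique up to scalar. They are normalized in the classical way: the coefficient of $abcm$ in $S$ is $1$ and the coefficient of $a^2b^2c^2$ in $T$ is $1$. (Equivalently, on $X^3+Y^3+Z^3+6mXYZ$ they take the values $S=m-m^4$ and $T=1-20m^3-8m^6$.) $\widetilde S,\widetilde T\in R$ are obtained from $S,T$ by the substitution $a\mapsto f_{3,0,0}$, $a_2\mapsto \frac13 f_{2,1,0}$, $a_3\mapsto\frac13 f_{2,0,1}$, $b\mapsto f_{0,3,0}$, $b_1\mapsto \frac13 f_{1,2,0}$, $b_3\mapsto\frac13 f_{0,2,1}$, $c\mapsto f_{0,0,3}$, $c_1\mapsto \frac13 f_{1,0,2}$, $c_2\mapsto\frac13 f_{0,1,2}$, $m\mapsto\frac16 f_{1,1,1}$. *)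

(* Defs.v *)
From mathcomp Require Import all_boot all_order all_algebra.
From mathcomp Require Export mpoly.

Set Implicit Arguments.
Unset Strict Implicit.
Unset Printing Implicit Defensive.

Import GRing.Theory.
Local Open Scope ring_scope.

(* (A_1, A_2, A_3) is stored with 0-based indices. *)
Definition triple := 'I_3 -> 'M[rat]_3.

(* Polynomial functions on triples; entry (i, j) of the k-th matrix is the
   variable of index mxvec_index k (mxvec_index i j).  Since rat is infinite,
   polynomials and polynomial functions are the same thing. *)
Notation polyfun := {mpoly rat[3 * (3 * 3)]}.

Definition coords (A : triple) : 'I_(3 * (3 * 3)) -> rat :=
  fun s => mxvec (\matrix_(k < 3) mxvec (A k)) 0 s.

Definition eval (f : polyfun) (A : triple) : rat := f.@[coords A].

Definition genmx (k : 'I_3) : 'M[polyfun]_3 :=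
  \matrix_(i, j) 'X_(mxvec_index k (mxvec_index i j)).

Lemma eval_genmx (A : triple) k i j : eval (genmx k i j) A = A k i j.
Proof. by rewrite /eval mxE mevalXU /coords mxvecE mxE mxvecE. Qed.

Definition inR (f : polyfun) : Prop :=
  forall g g' : 'M[rat]_3, \det g = 1 -> \det g' = 1 ->
  forall A : triple, eval f (fun k => g *m A k *m invmx g') = eval f A.

Definition ract (A : triple) (g : 'M[rat]_3) : triple :=
  fun j => \sum_(i < 3) g i j *: A i.

Definition inRSL (f : polyfun) : Prop :=
  inR f /\
  forall g : 'M[rat]_3, \det g = 1 ->
  forall A : triple, eval f (ract A g) = eval f A.

(* tmx n s k is t_(s+1) A_(k+1), with t_1, ..., t_n the outer variables. *)
Definition tmx (n : nat) (s : 'I_n) (k : 'I_3) : 'M[{mpoly polyfun[n]}]_3 :=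
  'X_s *: map_mx (@mpolyC n polyfun) (genmx k).

(* Only meant for i + j + k = 3. *)
Definition f_ (i j k : nat) : polyfun :=
  (\det (\sum_(s < 3) tmx s s))@_[multinom [tuple i; j; k]].

Definition h : polyfun :=
  let M : 'M[{mpoly polyfun[3]}]_(3 + 3) :=
    block_mx (tmx 1 1) (tmx 0 0)
             (tmx 0 0) (tmx 2 2) in
  (\det M)@_[multinom [tuple 2; 2; 2]]%N.

Definition q : polyfun :=
  let M : 'M[{mpoly polyfun[6]}]_(3 + (3 + 3)) :=
    col_mx (row_mx 0         (row_mx (tmx 0 0) (tmx 1 1)))
   (col_mx (row_mx (tmx 3 0) (row_mx 0         (tmx 2 2)))
           (row_mx (tmx 4 1) (row_mx (tmx 5 2) 0))) in
  (\det M)@_[multinom [tuple 2; 1; 2; 1; 2; 1]]%N.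

(* The coefficients are ordered as a, b, c, a2, a3, b1, b3, c1, c2, m. *)
Definition ternary_cubic (u : 'I_10 -> rat) : {mpoly rat[3]} :=
  let X := 'X_0 in let Y := 'X_1 in let Z := 'X_2 in
  u 0 *: X ^+ 3 + u 1 *: Y ^+ 3 + u 2 *: Z ^+ 3
  + (3 * u 3) *: (X ^+ 2 * Y) + (3 * u 4) *: (X ^+ 2 * Z)
  + (3 * u 5) *: (X * Y ^+ 2) + (3 * u 6) *: (Y ^+ 2 * Z)
  + (3 * u 7) *: (X * Z ^+ 2) + (3 * u 8) *: (Y * Z ^+ 2)
  + (6 * u 9) *: (X * Y * Z).

Definition cubic_invariant (P : {mpoly rat[10]}) : Prop :=
  forall g : 'M[rat]_3, \det g = 1 ->
  forall u v : 'I_10 -> rat,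
    ternary_cubic v
      = ternary_cubic u \mPo [tuple \sum_(j < 3) g i j *: 'X_j | i < 3] ->
    P.@[v] = P.@[u].

(* Invariants of degree 4 (resp. 6) are unique up to a scalar, so the
   normalization leaves a single S (resp. T). *)
Definition aronhold_S (S : {mpoly rat[10]}) : Prop :=
  [/\ S \is 4.-homog, cubic_invariant S
    & S@_[multinom [tuple 1; 1; 1; 0; 0; 0; 0; 0; 0; 1]]%N = 1].

Definition aronhold_T (T : {mpoly rat[10]}) : Prop :=
  [/\ T \is 6.-homog, cubic_invariant T
    & T@_[multinom [tuple 2; 2; 2; 0; 0; 0; 0; 0; 0; 0]]%N = 1].

Definition subst_f (P : {mpoly rat[10]}) : polyfun :=
  P \mPo [tuple f_ 3 0 0; f_ 0 3 0; f_ 0 0 3;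
                3^-1 *: f_ 2 1 0; 3^-1 *: f_ 2 0 1;
                3^-1 *: f_ 1 2 0; 3^-1 *: f_ 0 2 1;
                3^-1 *: f_ 1 0 2; 3^-1 *: f_ 0 1 2;
                6^-1 *: f_ 1 1 1].

Definition H : polyfun :=
  h - (1 / 3) *: (f_ 2 1 0 * f_ 0 1 2) - (1 / 3) *: (f_ 2 0 1 * f_ 0 2 1)
  + (2 / 3) *: (f_ 1 2 0 * f_ 1 0 2) + (1 / 12) *: f_ 1 1 1 ^+ 2.

Definition Q : polyfun :=
  q - (1 / 2) *: (h * f_ 1 1 1)
  + (3 / 2) *: (f_ 3 0 0 * f_ 0 3 0 * f_ 0 0 3)
  - (1 / 2) *: (f_ 3 0 0 * f_ 0 2 1 * f_ 0 1 2)
  - (1 / 2) *: (f_ 0 3 0 * f_ 2 0 1 * f_ 1 0 2)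
  - (1 / 2) *: (f_ 0 0 3 * f_ 2 1 0 * f_ 1 2 0)
  - (1 / 2) *: (f_ 1 1 1 * f_ 1 2 0 * f_ 1 0 2)
  + (1 / 2) *: (f_ 2 1 0 * f_ 1 0 2 * f_ 0 2 1)
  + (1 / 2) *: (f_ 1 2 0 * f_ 2 0 1 * f_ 0 1 2).

(* The degree d part of R^SL_3 is one-dimensional and spanned by F. *)
Definition spans_RSL (d : nat) (F : polyfun) : Prop :=
  F != 0 /\
  forall f : polyfun,
    (f \is d.-homog /\ inRSL f) <-> (exists c : rat, f = c *: F).

(* Main.v *)
Require Import Defs.
From mathcomp Require Import all_boot all_order all_algebra.
From mathcomp Require Import ring lra zify.

(** A triple (A_0, A_1, A_2) is a tensor in the product of three copies of a
    3-dimensional space, on which SL_3 x SL_3 x SL_3 acts: the adjoint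
    representation of E_6, graded by Z/3 with the Lie algebra of that group in
    degree 0, has this space in degree 1.  As for the adjoint action itself,
    there is an affine slice, a regular nilpotent tensor plus a 3-dimensional
    complement of the tangent space of its orbit,
      slice a b c = (I, E_01 + E_12, E_20 + a E_11 + b E_01 + c E_02),
    to which every invariant restricts injectively.  Both claims are thereby
    reduced to computations with polynomials in a, b, c.

    Injectivity (slice_determines) is infinitesimal, so that it is available
    over the rationals: at each point of the slice, the tangent vectors of the
    orbit and the directions of the slice span the whole space (transverse).
    An invariant f is killed by the linear vector fields of the Lie algebra; if
    it vanishes on the slice, so do, by induction on the order, all its
    derivatives, since the commutator of a linear vector field with a constant
    one is constant (derivs_lie, slice_eq0).  A suitable derivative of a nonzero
    polynomial is a nonzero constant, hence f = 0.

    A one-parameter torus in GL_3 x GL_3 x GL_3 fixes the nilpotent tensor and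
    scales a, b, c with weights 6, 9, 12, in units where an invariant of degree
    d has weight d (eval_slice_scaling).  Hence the restriction of an invariant
    of degree 6 is a multiple of a, and that of an invariant of degree 9 is a
    multiple of b.  As H and Q restrict to 2a/3 and -b/2, they span these
    spaces, provided that they are invariant.

    Invariance of H and Q (inRSL_H, inRSL_Q): under the first two factors they
    are multiplied by powers of determinants, so by density of det A_0 != 0 it
    is enough to look at triples (I, B, C).  There Schur complements express h
    and q by determinants of size 3 (eval_h1, eval_q1), and invariance under the
    third factor is checked on the transvections which fix A_0 and on the
    exchange of A_0 and A_1; together they generate (rel_inv_inRSL).

    For the relation it remains to restrict S~ and T~, which are S and T of the
    plane cubic det (x A_0 + y A_1 + z A_2).  On the slice this cubic is, up to
    a translation of x and y by multiples of z, in Weierstrass form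
    a x^3 + c z^3 + 3 b_3 y^2 z + 3 c_1 x z^2, where invariance under the
    diagonal torus leaves a single monomial of S and one of T.  Their
    coefficients, 1 and 4, follow from the normalization by comparison with the
    Hesse cubics X^3 + Y^3 + t Z^3 + 6XYZ, whose flex (1 : -1 : 0) brings them
    into Weierstrass form (hesse_weierstrass).  The relation becomes the
    identity
      b^2/4 = 8a^3/27 + 18 a S~ - (27/4) T~,
      S~ = - (a^2/3 + c)/27,  T~ = (4/27) (2a^3/27 - 2ac/3 - b^2/4). *)

Set Implicit Arguments.
Unset Strict Implicit.
Unset Printing Implicit Defensive.

Import Order.TTheory GRing.Theory Num.Theory.
Local Open Scope ring_scope.

(** * Polynomials vanishing on a transverse slice *)

Section PolynomialTools.

Variables (R : numFieldType) (n : nat).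
Implicit Types (f F : {mpoly R[n]}) (p v x : 'I_n -> R).

Lemma mderivXU i k : ('X_i : {mpoly R[n]})^`M(k) = (i == k)%:R.
Proof.
rewrite mderivX mnm1E; case: eqP => [->|_]; last by rewrite scale0r.
by rewrite -[X in (X - _)%MM]add0m addmK mpolyX0 scale1r.
Qed.

Definition line_poly p v : {mpoly R[n]} -> {poly R} :=
  mmap polyC (fun i => (p i)%:P + v i *: 'X).

Lemma horner_line_poly p v f t :
  (line_poly p v f).[t] = f.@[fun i => p i + t * v i].
Proof.
rewrite /line_poly /mmap /mmap1 mevalE horner_sum; apply: eq_bigr => m _.
rewrite hornerM hornerC horner_prod; congr (_ * _); apply: eq_bigr => i _.
by rewrite horner_exp !hornerE mulrC.
Qed.

(** The chain rule along a line; it is compatible with sums and products of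
    polynomials, so that it reduces to the variables. *)
Lemma deriv_line_poly p v f :
  (line_poly p v f)^`() = \sum_i v i *: line_poly p v f^`M(i).
Proof.
pose good F := (line_poly p v F)^`() = \sum_i v i *: line_poly p v F^`M(i).
have goodD F G : good F -> good G -> good (F + G).
  rewrite /good => gF gG; rewrite /line_poly mmapD derivD gF gG -big_split /=.
  by apply: eq_bigr => i _; rewrite mderivD mmapD scalerDr.
have goodZ c F : good F -> good (c *: F).
  rewrite /good => gF; rewrite /line_poly mmapZ deriv_mulC gF big_distrr /=.
  by apply: eq_bigr => i _; rewrite mderivZ mmapZ scalerAr.
have goodM F G : good F -> good G -> good (F * G).
  rewrite /good => gF gG; rewrite /line_poly rmorphM derivM gF gG.
  rewrite mulr_suml mulr_sumr -big_split /=; apply: eq_bigr => i _.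
  by rewrite mderivM mmapD !rmorphM /= scalerDr scalerAl scalerAr.
have good1 : good 1.
  rewrite /good /line_poly rmorph1 derivC big1 // => i _.
  by rewrite mderivC mmap0 scaler0.
have goodX i : good 'X_i.
  rewrite /good /line_poly mmapX mmap1U derivD derivC derivZ derivX add0r.
  rewrite (bigD1 i) //= big1 ?addr0 => [|j /negPf ji].
    by rewrite mderivXU eqxx rmorph1.
  by rewrite mderivXU eq_sym ji mmap0 scaler0.
change (good f); rewrite [f]mpolyE; apply: big_ind => //.
  by have := goodZ 0 _ good1; rewrite scale0r.
move=> m _; apply: goodZ; rewrite mpolyXE_id; apply: big_ind => // i _.
by elim: (m i) => [|k IHk]; rewrite ?expr0 // exprS; apply: goodM.
Qed.

(* A univariate polynomial taking a single value is constant. *)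
Lemma poly_const_fun (P : {poly R}) c : (forall t, P.[t] = c) -> P = c%:P.
Proof.
move=> Pc; apply/eqP; rewrite -subr_eq0; apply/eqP.
pose rs := [seq k%:R : R | k <- iota 0 (size (P - c%:P))].
apply: (@roots_geq_poly_eq0 _ _ rs).
- by apply/allP => _ /mapP [k _ ->]; rewrite rootE !hornerE Pc subrr.
- by rewrite map_inj_uniq ?iota_uniq // => i j /eqP; rewrite eqr_nat => /eqP.
- by rewrite size_map size_iota.
Qed.

Lemma dir_deriv_eq0 f p v c : (forall t, f.@[fun i => p i + t * v i] = c) ->
  \sum_i v i * f^`M(i).@[p] = 0.
Proof.
move=> fc; have /(congr1 deriv) : line_poly p v f = c%:P.
  by apply: poly_const_fun => t; rewrite horner_line_poly.
rewrite derivC deriv_line_poly => /(congr1 (horner^~ 0)); rewrite horner0.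
rewrite horner_sum => fc0; rewrite -[RHS]fc0; apply: eq_bigr => i _.
rewrite hornerZ horner_line_poly; congr (_ * _); apply: meval_eq => j.
by rewrite mul0r addr0.
Qed.

(** The derivative of f along the linear vector field p |-> M p. *)
Definition lie (M : 'M[R]_n) f := \sum_i (\sum_j M i j *: 'X_j) * f^`M(i).

(** The commutator of a linear vector field with a constant one is constant. *)
Lemma lie_mderiv M f k :
  lie M f^`M(k) = (lie M f)^`M(k) - \sum_i M i k *: f^`M(i).
Proof.
rewrite /lie raddf_sum /= -sumrB; apply: eq_bigr => i _.
rewrite mderivM mderiv_comm addrC; apply/eqP; rewrite -subr_eq0; apply/eqP.
have -> : (\sum_j M i j *: 'X_j : {mpoly R[n]})^`M(k) = (M i k)%:MP.
  rewrite raddf_sum /= (bigD1 k) //= big1 ?addr0 => [|j /negPf jk].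
    by rewrite mderivZ mderivXU eqxx -alg_mpolyC.
  by rewrite mderivZ mderivXU jk scaler0.
by rewrite mul_mpolyC; ring.
Qed.

Lemma lieD M f F : lie M (f + F) = lie M f + lie M F.
Proof.
by rewrite /lie -big_split; apply: eq_bigr => i _; rewrite mderivD mulrDr.
Qed.

Lemma lieZ M c f : lie M (c *: f) = c *: lie M f.
Proof.
by rewrite /lie scaler_sumr; apply: eq_bigr => i _; rewrite mderivZ scalerAr.
Qed.

Lemma meval_lie M f p :
  (lie M f).@[p] = \sum_i (\sum_j M i j * p j) * f^`M(i).@[p].
Proof.
rewrite /lie raddf_sum; apply: eq_bigr => i _ /=; rewrite mevalM raddf_sum.
by congr (_ * _); apply: eq_bigr => j _; rewrite /= mevalZ mevalXU.
Qed.

(** The linear span of the partial derivatives of f of order k. *)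
Inductive derivs f : nat -> {mpoly R[n]} -> Prop :=
| Derivs0 : derivs f 0 f
| DerivsS k F i : derivs f k F -> derivs f k.+1 F^`M(i)
| DerivsZero k : derivs f k 0
| DerivsLin k c F G : derivs f k F -> derivs f k G -> derivs f k (c *: F + G).

Lemma derivs_sum f k (c : 'I_n -> R) (g : 'I_n -> {mpoly R[n]}) :
  (forall i : 'I_n, derivs f k (g i)) -> derivs f k (\sum_i c i *: g i).
Proof.
move=> dg; apply: (big_ind (derivs f k)).
- exact: DerivsZero.
- by move=> F G dF dG; rewrite -[F]scale1r; apply: DerivsLin.
- by move=> i _; rewrite -[_ *: _]addr0; apply: DerivsLin (dg i) _; constructor.
Qed.

(** The commutators that appear when M is moved across k constant derivations
    have order k again, and M kills f itself. *)
Lemma derivs_lie f M k F : lie M f = 0 -> derivs f k F -> derivs f k (lie M F).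
Proof.
move=> Mf; elim=> {k F} [|k F i dF IH|k|k c F G _ IHF _ IHG].
- by rewrite Mf; constructor.
- rewrite lie_mderiv addrC -scaleN1r; apply: DerivsLin; last exact: DerivsS.
  by apply: derivs_sum => j; apply: DerivsS.
- by rewrite -(scale0r (0 : {mpoly R[n]})) lieZ scale0r; constructor.
- by rewrite lieD lieZ; apply: DerivsLin.
Qed.

Lemma derivs_mderivm f m : derivs f (mdeg m) f^`M[m].
Proof.
move dE: (mdeg m) => d; elim: d m dE => [m /eqP|d IH m md].
  by rewrite mdeg_eq0 => /eqP ->; rewrite mderivm0m; constructor.
have [i mi] : exists i, m i != 0%N.
  apply/existsP; apply: contra_eqT md; rewrite negb_exists => /forallP m0.
  by rewrite mdegE big1 // => i _; apply/eqP; rewrite -[_ == _]negbK.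
have mE : (m - U_(i) + U_(i) = m)%MM.
  apply/mnmP => j; rewrite mnmDE mnmBE mnm1E subnK //.
  by case: eqP => // <-; rewrite lt0n.
rewrite -mE mderivmDm mderivmU1m; apply: DerivsS; apply: IH.
by have := congr1 (@mdeg n) mE; rewrite mdegD mdeg1 md addn1 => -[].
Qed.

(** This is where characteristic 0 enters: the factorials do not vanish. *)
Lemma mderivm_mlead f :
  f^`M[mlead f] = (f@_(mlead f) *+ \prod_(i < n) (mlead f i)`!)%:MP.
Proof.
apply/mpolyP => m; rewrite mcoeff_mderivm mcoeffC; case: eqP => [->|/eqP m0].
  rewrite addm0 mulr1; congr (_ *+ _); apply: eq_bigr => i _.
  by rewrite ffactnn.
rewrite mcoeff_gt_mlead ?mul0rn ?mulr0 //; apply: lt_mdeg_ltmc.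
by rewrite mdegD -[X in (X < _)%N]addn0 ltn_add2l lt0n mdeg_eq0.
Qed.

(** The derivatives of order k+1 vanish on P once those of order k do: let w be
    the gradient of such a derivative F at p.  Then w is orthogonal to the
    directions D because F vanishes along P, and to the vectors M p because
    lie M F is a derivative of order k. *)
Lemma slice_eq0_lie f (G : 'M[R]_n -> Prop) (P D : ('I_n -> R) -> Prop) :
  (forall M, G M -> lie M f = 0) ->
  (exists p, P p) ->
  (forall p v t, P p -> D v -> P (fun i => p i + t * v i)) ->
  (forall p, P p -> forall w : 'I_n -> R,
     (forall M, G M -> \sum_i (\sum_j M i j * p j) * w i = 0) ->
     (forall v, D v -> \sum_i v i * w i = 0) -> forall i, w i = 0) ->
  (forall p, P p -> f.@[p] = 0) -> f = 0.
Proof.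
move=> Gf [p0 Pp0] PD span f0.
have derivs0 k : forall F, derivs f k F -> forall p, P p -> F.@[p] = 0.
  have [m km] := ubnP k; elim: m k km => // m IHm k; rewrite ltnS => km F dF.
  elim: dF km => {k F} [|k F i dF _|k|k c F H _ IHF _ IHH] km p Pp.
  - exact: f0.
  - apply: (span p Pp (fun i => F^`M(i).@[p])) => [M GM|v Dv].
      rewrite -meval_lie (IHm k km (lie M F)) //.
      by apply: derivs_lie => //; apply: Gf.
    by apply: (@dir_deriv_eq0 _ _ _ 0) => t; apply: (IHm k) => //; apply: PD.
  - exact: meval0.
  - by rewrite mevalD mevalZ IHF // IHH // mulr0 addr0.
have /(derivs0 _ _)/(_ p0 Pp0) := derivs_mderivm f (mlead f).
rewrite mderivm_mlead mevalC => /eqP; rewrite -mulr_natr mulf_eq0 pnatr_eq0.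
rewrite mleadc_eq0 => /orP [/eqP //|].
rewrite -[_ == _]negbK -lt0n prodn_gt0 //.
by move=> i; rewrite fact_gt0.
Qed.

(** The slice is the whole space, and no vector field is involved. *)
Lemma meval_inj f F : (forall p, f.@[p] = F.@[p]) -> f = F.
Proof.
move=> fF; apply/eqP; rewrite -subr_eq0; apply/eqP.
apply: (@slice_eq0_lie _ (fun=> False) (fun=> True) (fun=> True)) => //.
- by exists (fun=> 0).
- move=> _ _ w _ w0 i; have := w0 (fun j => (i == j)%:R) I.
  rewrite (bigD1 i) //= eqxx mul1r big1 ?addr0 // => j /negPf.
  by rewrite eq_sym => ->; rewrite mul0r.
- by move=> p _; rewrite mevalB fF subrr.
Qed.

(** The principle of irrelevance of algebraic inequalities. *)
Lemma meval_dense f F u : u != 0 ->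
  (forall p, u.@[p] != 0 -> f.@[p] = F.@[p]) -> f = F.
Proof.
move=> u0 fF; apply/eqP; rewrite -subr_eq0; apply/eqP.
apply: (mulfI u0); rewrite mulr0; apply: meval_inj => p.
rewrite mevalM mevalB meval0; have [->|up] := eqVneq u.@[p] 0.
  by rewrite mul0r.
by rewrite fF // subrr mulr0.
Qed.

(** Invariance along straight lines is all that is asked, because the groups at
    hand contain the elements 1 + tN for enough square-zero matrices N; this
    avoids exponentials and a dense set of group elements. *)
Lemma slice_eq0 f (G : 'M[R]_n -> Prop) (P D : ('I_n -> R) -> Prop) :
  (forall M, G M -> forall p t,
     f.@[fun i => p i + t * \sum_j M i j * p j] = f.@[p]) ->
  (exists p, P p) ->
  (forall p v t, P p -> D v -> P (fun i => p i + t * v i)) ->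
  (forall p, P p -> forall w : 'I_n -> R,
     (forall M, G M -> \sum_i (\sum_j M i j * p j) * w i = 0) ->
     (forall v, D v -> \sum_i v i * w i = 0) -> forall i, w i = 0) ->
  (forall p, P p -> f.@[p] = 0) -> f = 0.
Proof.
move=> Gf; apply: slice_eq0_lie => M /Gf Mf; apply: meval_inj => p.
by rewrite meval_lie meval0 (dir_deriv_eq0 (c := f.@[p])).
Qed.

(** Numbers w and c in place of indeterminates: with powers of 2 a single
    scaling identity determines a weight. *)
Lemma mcoeff_scaling f (w : 'I_n -> R) c m :
  (forall x, f.@[fun i => w i * x i] = c * f.@[x]) -> f@_m != 0 ->
  \prod_i w i ^+ m i = c.
Proof.
move=> fw fm.
pose f' := \sum_(k <- msupp f) (f@_k * \prod_i w i ^+ k i) *: 'X_[k].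
have f'E k : f'@_k = f@_k * \prod_i w i ^+ k i.
  rewrite raddf_sum /=; have [kf|kf] := boolP (k \in msupp f); last first.
    rewrite (memN_msupp_eq0 kf) mul0r big_seq big1 // => j jf.
    rewrite mcoeffZ mcoeffX; case: eqP => [jk|]; last by rewrite mulr0.
    by rewrite -jk jf in kf.
  rewrite (bigD1_seq k) ?msupp_uniq //= mcoeffZ mcoeffX eqxx mulr1.
  rewrite [X in _ + X]big1 ?addr0 // => j /negPf jk.
  by rewrite mcoeffZ mcoeffX jk mulr0.
have /mpolyP/(_ m) : f' = c *: f.
  apply: meval_inj => x; rewrite mevalZ -fw [RHS]mevalE raddf_sum /=.
  apply: eq_bigr => k _; rewrite mevalZ mevalX -mulrA -big_split /=.
  by congr (_ * _); apply: eq_bigr => i _; rewrite exprMn.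
by rewrite f'E mcoeffZ mulrC => /(mulIf fm).
Qed.

(** Weights leave few monomials that can contribute at a sparse point x; s lists
    them. *)
Lemma meval_seq f x (s : seq 'X_{1..n}) : uniq s ->
  (forall m, f@_m != 0 -> \prod_i x i ^+ m i != 0 -> m \in s) ->
  f.@[x] = \sum_(m <- s) f@_m * \prod_i x i ^+ m i.
Proof.
move=> us fs; rewrite mevalE.
pose a := [pred m | f@_m * \prod_i x i ^+ m i != 0].
have aE (r : seq _) : \sum_(m <- r) f@_m * \prod_i x i ^+ m i
    = \sum_(m <- filter a r) f@_m * \prod_i x i ^+ m i.
  rewrite big_filter [LHS](bigID a) /= [X in _ + X]big1 ?addr0 // => m.
  by rewrite negbK => /eqP.
rewrite [LHS]aE [RHS]aE; apply: perm_big; apply: uniq_perm.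
- by rewrite filter_uniq ?msupp_uniq.
- by rewrite filter_uniq.
- move=> m; rewrite !mem_filter; apply/andP/andP => -[am _]; split=> //.
    by move: am; rewrite /= mulf_eq0 negb_or => /andP [/fs].
  by move: am; rewrite /= mulf_eq0 negb_or mcoeff_msupp => /andP [].
Qed.

(** Evaluation at points without zero coordinates is enough, which lets Schur
    complements divide by the variables. *)
Lemma mcoeff_fun (P : {mpoly R[n]}) (s : seq (R * 'X_{1..n})) m :
  (forall x, (forall i, x i != 0) ->
     P.@[x] = \sum_(c <- s) c.1 * \prod_i x i ^+ c.2 i) ->
  P@_m = \sum_(c <- s | c.2 == m) c.1.
Proof.
move=> Ps; have -> : P = \sum_(c <- s) c.1 *: 'X_[c.2].
  apply: (@meval_dense _ _ (\prod_i 'X_i)) => [|x].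
    apply/eqP => /(congr1 (meval (fun=> 1))); rewrite meval0 rmorph_prod.
    rewrite big1 => [/eqP|i _]; first by rewrite oner_eq0.
    by rewrite /= mevalXU.
  rewrite rmorph_prod raddf_sum => /prodf_neq0 xP; rewrite Ps.
    by apply: eq_bigr => c _; rewrite /= mevalZ mevalX.
  by move=> i; have := xP i isT; rewrite /= mevalXU.
rewrite raddf_sum [RHS]big_mkcond; apply: eq_bigr => c _ /=.
by rewrite mcoeffZ mcoeffX; case: eqP; rewrite ?mulr1 ?mulr0.
Qed.

End PolynomialTools.

(** * Determinants of pencils and nets of 3 x 3 matrices *)

Section ThreeByThree.

Variable R : comNzRingType.
Implicit Types B C M : 'M[R]_3.

Lemma sum3E (V : nmodType) (F : 'I_3 -> V) : \sum_i F i = F 0 + F 1 + F 2.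
Proof.
rewrite !big_ord_recl big_ord0 addr0 addrA.
by congr (F _ + F _ + F _); apply: val_inj.
Qed.

Lemma mulmx3E B C i j :
  (B *m C) i j = B i 0 * C 0 j + B i 1 * C 1 j + B i 2 * C 2 j.
Proof. by rewrite mxE sum3E. Qed.

Lemma det2E (M : 'M[R]_2) : \det M = M 0 0 * M 1 1 - M 0 1 * M 1 0.
Proof.
rewrite (expand_det_row _ ord0) !big_ord_recl big_ord0 addr0 /cofactor.
rewrite !det_mx11 !mxE /= expr0 expr1 mul1r mulN1r mulrN.
by congr (M _ _ * M _ _ - M _ _ * M _ _); apply: val_inj.
Qed.

Lemma det3E M : \det M =
    M 0 0 * (M 1 1 * M 2 2 - M 1 2 * M 2 1)
  - M 0 1 * (M 1 0 * M 2 2 - M 1 2 * M 2 0)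
  + M 0 2 * (M 1 0 * M 2 1 - M 1 1 * M 2 0).
Proof.
rewrite (expand_det_row _ 0) sum3E /cofactor !det2E !mxE /=.
rewrite -![(-1) ^+ (0 + _)]signr_odd /= expr0 expr1 !mul1r mulN1r mulrN.
by congr (_ * (M _ _ * M _ _ - M _ _ * M _ _)
  - _ * (M _ _ * M _ _ - M _ _ * M _ _)
  + _ * (M _ _ * M _ _ - M _ _ * M _ _)); apply: val_inj.
Qed.

(** The polarization of the determinant: det (B + y C) has the term y pol B C.
    Also pol B C = tr (adj B C), and pol C I is the second elementary symmetric
    function of the eigenvalues of C. *)
Definition pol B C : R :=
    C 0 0 * (B 1 1 * B 2 2 - B 1 2 * B 2 1)
  - C 0 1 * (B 1 0 * B 2 2 - B 1 2 * B 2 0)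
  + C 0 2 * (B 1 0 * B 2 1 - B 1 1 * B 2 0)
  - C 1 0 * (B 0 1 * B 2 2 - B 0 2 * B 2 1)
  + C 1 1 * (B 0 0 * B 2 2 - B 0 2 * B 2 0)
  - C 1 2 * (B 0 0 * B 2 1 - B 0 1 * B 2 0)
  + C 2 0 * (B 0 1 * B 1 2 - B 0 2 * B 1 1)
  - C 2 1 * (B 0 0 * B 1 2 - B 0 2 * B 1 0)
  + C 2 2 * (B 0 0 * B 1 1 - B 0 1 * B 1 0).

Definition pol3 (A B C : 'M[R]_3) : R := pol (A + B) C - pol A C - pol B C.

Lemma det_pencil x y B C : \det (x *: B + y *: C) =
  x ^+ 3 * \det B + x ^+ 2 * y * pol B C + x * y ^+ 2 * pol C B + y ^+ 3 * \det C.
Proof. by rewrite !det3E !mxE /pol; ring. Qed.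

Lemma det_net x y z A B C : \det (x *: A + y *: B + z *: C) =
  x ^+ 3 * \det A + y ^+ 3 * \det B + z ^+ 3 * \det C
  + x ^+ 2 * y * pol A B + x ^+ 2 * z * pol A C + x * y ^+ 2 * pol B A
  + y ^+ 2 * z * pol B C + x * z ^+ 2 * pol C A + y * z ^+ 2 * pol C B
  + x * y * z * pol3 A B C.
Proof. by rewrite !det3E !mxE /pol3 /pol !mxE; ring. Qed.

End ThreeByThree.

(** * Coefficients of determinants at a given triple *)

(** The coefficients of P are polynomial functions of a triple; here they are
    specialized to A, and the outer variables to x. *)
Definition evalx n (A : triple) (P : {mpoly polyfun[n]}) (x : 'I_n -> rat) : rat :=
  (map_mpoly (meval (coords A)) P).@[x].

Lemma prod3E (R : comNzRingType) (F : 'I_3 -> R) : \prod_i F i = F 0 * F 1 * F 2.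
Proof.
rewrite !big_ord_recl big_ord0 mulr1 mulrA.
by congr (F _ * F _ * F _); apply: val_inj.
Qed.

Lemma prod_mnm3 (R : comNzRingType) (x : 'I_3 -> R) i j k :
  \prod_s x s ^+ [multinom [tuple i; j; k]] s = x 0 ^+ i * x 1 ^+ j * x 2 ^+ k.
Proof. by rewrite prod3E. Qed.

(** The determinants are only known through their values, so a coefficient is
    read off from an expansion that holds at all nonzero x. *)
Lemma eval_mcoeff n (P : {mpoly polyfun[n]}) A (s : seq (rat * 'X_{1..n})) c :
  uniq [seq d.2 | d <- s] -> c \in s ->
  (forall x, (forall i, x i != 0) ->
     evalx A P x = \sum_(d <- s) d.1 * \prod_i x i ^+ d.2 i) ->
  eval P@_(c.2) A = c.1.
Proof.
move=> us cs Ps; rewrite /eval -mcoeff_map_mpoly (mcoeff_fun _ Ps).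
rewrite -big_filter (_ : filter _ s = [:: c]) ?big_seq1 //.
have us' : uniq s by apply: map_uniq us.
apply: perm_small_eq => //; apply: uniq_perm; rewrite ?filter_uniq // => d.
rewrite mem_filter inE; apply/andP/eqP => [[/eqP cd ds]|-> //].
elim: s us cs ds {us' Ps} => //= e s IHs /andP [/mapP es us].
rewrite !inE => /orP [/eqP ce|cs] /orP [/eqP de|ds]; last exact: IHs.
- by rewrite ce de.
- by case: es; exists d; rewrite // cd ce.
- by case: es; exists c; rewrite // -cd de.
Qed.

Lemma eval_mcoeffZ n (P : {mpoly polyfun[n]}) m A A' c :
  (forall x, evalx A' P x = c * evalx A P x) ->
  eval P@_m A' = c * eval P@_m A.
Proof.
move=> Pc; rewrite /eval -!mcoeff_map_mpoly -mcoeffZ; congr (mcoeff m _).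
by apply: meval_inj => x; rewrite mevalZ; apply: Pc.
Qed.

Section Specialization.

Variables (n : nat) (A : triple) (x : 'I_n -> rat).

Let spec : {mpoly polyfun[n]} -> rat := meval x \o map_mpoly (meval (coords A)).

Lemma evalx_det k (M : 'M[{mpoly polyfun[n]}]_k) :
  evalx A (\det M) x = \det (map_mx spec M).
Proof. by rewrite det_map_mx. Qed.

Lemma map_tmx s k : map_mx spec (tmx s k) = x s *: A k.
Proof.
apply/matrixP => i j; rewrite !mxE /spec /= rmorphM /= mevalM.
rewrite map_mpolyX mevalXU map_mpolyC mevalC; congr (_ * _).
by rewrite -[RHS]eval_genmx mxE.
Qed.

End Specialization.

Lemma evalx_f A x :
  evalx A (\det (\sum_(s < 3) tmx s s)) x = \det (\sum_(s < 3) x s *: A s).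
Proof.
rewrite evalx_det map_mx_sum; congr (\det _); apply: eq_bigr => s _.
exact: map_tmx.
Qed.

Definition cubic_coefs (R : Type) (a b c a2 a3 b1 b3 c1 c2 m : R) :
    seq (R * 'X_{1..3}) :=
  [:: (a, [multinom [tuple 3; 0; 0]]%N); (b, [multinom [tuple 0; 3; 0]]%N);
      (c, [multinom [tuple 0; 0; 3]]%N); (a2, [multinom [tuple 2; 1; 0]]%N);
      (a3, [multinom [tuple 2; 0; 1]]%N); (b1, [multinom [tuple 1; 2; 0]]%N);
      (b3, [multinom [tuple 0; 2; 1]]%N); (c1, [multinom [tuple 1; 0; 2]]%N);
      (c2, [multinom [tuple 0; 1; 2]]%N); (m, [multinom [tuple 1; 1; 1]]%N)].

Lemma cubic_coefs_mem (R : eqType) (F : nat -> nat -> nat -> R)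
    a b c a2 a3 b1 b3 c1 c2 m (s := cubic_coefs a b c a2 a3 b1 b3 c1 c2 m) :
  (forall i j k d, (d, [multinom [tuple i; j; k]]%N) \in s -> F i j k = d) ->
  [/\ [/\ F 3%N 0%N 0%N = a, F 0%N 3%N 0%N = b & F 0%N 0%N 3%N = c],
      [/\ F 2%N 1%N 0%N = a2, F 2%N 0%N 1%N = a3, F 1%N 2%N 0%N = b1 &
          F 0%N 2%N 1%N = b3] &
      [/\ F 1%N 0%N 2%N = c1, F 0%N 1%N 2%N = c2 & F 1%N 1%N 1%N = m]].
Proof. by move=> Fs; split; split; apply: Fs; rewrite !inE eqxx ?orbT. Qed.

Lemma eval_fE A :
  [/\ [/\ eval (f_ 3 0 0) A = \det (A 0), eval (f_ 0 3 0) A = \det (A 1) &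
          eval (f_ 0 0 3) A = \det (A 2)],
      [/\ eval (f_ 2 1 0) A = pol (A 0) (A 1), eval (f_ 2 0 1) A = pol (A 0) (A 2),
          eval (f_ 1 2 0) A = pol (A 1) (A 0) & eval (f_ 0 2 1) A = pol (A 1) (A 2)] &
      [/\ eval (f_ 1 0 2) A = pol (A 2) (A 0), eval (f_ 0 1 2) A = pol (A 2) (A 1) &
          eval (f_ 1 1 1) A = pol3 (A 0) (A 1) (A 2)]].
Proof.
apply: (cubic_coefs_mem (F := fun i j k => eval (f_ i j k) A)) => i j k d ds.
apply: (eval_mcoeff (c := (d, _)) _ ds) => // x _.
rewrite evalx_f sum3E det_net !big_cons big_nil /= !prod_mnm3.
by rewrite !expr0 !expr1; ring.
Qed.

(** * Block determinants *)

Definition block3 (R : nmodType) k (a b c d e f g h i : 'M[R]_k) :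
    'M[R]_(k + (k + k)) :=
  col_mx (row_mx a (row_mx b c))
    (col_mx (row_mx d (row_mx e f)) (row_mx g (row_mx h i))).

Lemma map_block3 (R S : nmodType) k (u : R -> S) (a b c d e f g h i : 'M[R]_k) :
  map_mx u (block3 a b c d e f g h i) =
  block3 (map_mx u a) (map_mx u b) (map_mx u c) (map_mx u d) (map_mx u e)
    (map_mx u f) (map_mx u g) (map_mx u h) (map_mx u i).
Proof. by rewrite !(map_col_mx, map_row_mx). Qed.

Section Blocks.

Variables (R : comNzRingType) (k : nat).
Implicit Types a b c d e f g h i : 'M[R]_k.

Lemma mul_block3 a b c d e f g h i a' b' c' d' e' f' g' h' i' :
  block3 a b c d e f g h i *m block3 a' b' c' d' e' f' g' h' i' =
  block3 (a *m a' + b *m d' + c *m g') (a *m b' + b *m e' + c *m h')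
         (a *m c' + b *m f' + c *m i')
         (d *m a' + e *m d' + f *m g') (d *m b' + e *m e' + f *m h')
         (d *m c' + e *m f' + f *m i')
         (g *m a' + h *m d' + i *m g') (g *m b' + h *m e' + i *m h')
         (g *m c' + h *m f' + i *m i').
Proof.
rewrite /block3 !(mul_col_mx, mul_row_col, mul_mx_row, add_row_mx).
by rewrite !addrA.
Qed.

Lemma block3E a b c d e f g h i : block3 a b c d e f g h i =
  block_mx a (row_mx b c) (col_mx d g) (block_mx e f h i).
Proof.
rewrite /block3 [RHS]/block_mx; congr (col_mx _ _).
exact: (block_mxEh d (row_mx e f) g (row_mx h i)).
Qed.

Lemma det_block3_diag a : \det (block3 a 0 0 0 a 0 0 0 a) = \det a ^+ 3.
Proof.
by rewrite block3E row_mx0 !det_lblock; ring.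
Qed.

(** The determinant of a product of three transvections, as for the rotation
    matrix of size 2. *)
Lemma det_block_rot : \det (block_mx 0 (- 1%:M) 1%:M 0 : 'M[R]_(k + k)) = 1.
Proof.
have -> : block_mx 0 (- 1%:M) 1%:M 0 = block_mx 1%:M (- 1%:M) 0 1%:M
    *m block_mx 1%:M 0 1%:M 1%:M *m block_mx 1%:M (- 1%:M) 0 1%:M :> 'M[R]_(k + k).
  rewrite !mulmx_block.
  by rewrite !(mulmx0, mul0mx, mulmx1, mul1mx, add0r, addr0, subrr, addNr).
by rewrite !det_mulmx det_ublock det_lblock !det1 !mulr1.
Qed.

Lemma det_block3_rot :
  \det (block3 0 (- 1%:M) 0 1%:M 0 0 0 0 1%:M : 'M[R]_(k + (k + k))) = 1.
Proof.
pose u : 'M[R]_(k + (k + k)) := block3 1%:M (- 1%:M) 0 0 1%:M 0 0 0 1%:M.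
pose l : 'M[R]_(k + (k + k)) := block3 1%:M 0 0 1%:M 1%:M 0 0 0 1%:M.
have -> : block3 0 (- 1%:M) 0 1%:M 0 0 0 0 1%:M = u *m l *m u.
  rewrite !mul_block3.
  by rewrite !(mulmx0, mul0mx, mulmx1, mul1mx, add0r, addr0, subrr, addNr).
rewrite !det_mulmx /u /l !block3E row_mx0 col_mx0.
by rewrite !(det_ublock, det_lblock) !det1 !mulr1.
Qed.

(** The permutation of two block indices is applied on both sides, so that its
    sign cancels. *)
Lemma det_block3_swap a b c d e f g h i :
  \det (block3 a b c d e f g h i) = \det (block3 a c b g i h d f e).
Proof.
pose P : 'M[R]_(k + (k + k)) := block3 1%:M 0 0 0 0 1%:M 0 1%:M 0.
have PP : P *m P = 1%:M.
  rewrite mul_block3 !(mulmx0, mul0mx, mulmx1, add0r, addr0).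
  by rewrite block3E row_mx0 col_mx0 -!scalar_mx_block.
rewrite -[LHS]mul1r -(det1 R (k + (k + k))) -PP det_mulmx mulrAC -!det_mulmx.
by rewrite !mul_block3 !(mulmx0, mul0mx, mulmx1, mul1mx, add0r, addr0).
Qed.

End Blocks.

Section Schur.

Variables (F : fieldType) (m n : nat).

Lemma det_block_scalar x (U : 'M[F]_(m, n)) (V : 'M[F]_(n, m)) (W : 'M[F]_n) :
  x != 0 ->
  \det (block_mx x%:M U V W) = x ^+ m * \det (W - x^-1 *: (V *m U)).
Proof.
move=> x0; have -> : block_mx x%:M U V W =
    block_mx 1%:M 0 (x^-1 *: V) 1%:M *m block_mx x%:M U 0 (W - x^-1 *: (V *m U)).
  rewrite mulmx_block !(mulmx0, mul0mx, mul1mx, addr0, add0r) mul_mx_scalar.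
  by rewrite scalerA mulfV // scale1r -scalemxAl addrC subrK.
by rewrite det_mulmx det_lblock det_ublock !det1 det_scalar !mul1r.
Qed.

End Schur.

Section Schur3.

Variable F : fieldType.
Implicit Types B C P U V W : 'M[F]_3.

Lemma det_block33_scalar x U V W : x != 0 ->
  \det (block_mx x%:M U V W) = \det (x *: W - V *m U).
Proof.
move=> x0; rewrite det_block_scalar // -detZ scalerBr scalerA mulfV //.
by rewrite scale1r.
Qed.

Lemma det_block33_offdiag x P W : x != 0 ->
  \det (block_mx P x%:M x%:M W) = \det (W *m P - (x ^+ 2)%:M).
Proof.
move=> x0; rewrite -[LHS]mulr1 -(det_block_rot F 3) -det_mulmx mulmx_block.
rewrite !(mulmx0, mulmx1, mulmxN, addr0, add0r) det_block33_scalar //.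
by rewrite mulmxN opprK scalerN scale_scalar_mx -expr2 addrC.
Qed.

(** The factor that rotates the first two columns moves the scalar block to the
    corner, ready for two Schur complements. *)
Lemma det_block3_offdiag (x : 'I_6 -> F) B C : (forall i, x i != 0) ->
  \det (block3 0 (x 0)%:M (x 1 *: B) (x 3)%:M 0 (x 2 *: C) (x 4 *: B) (x 5 *: C) 0)
  = \det ((x 1 * x 3 * x 5) *: (C *m B) + (x 0 * x 2 * x 4) *: (B *m C)).
Proof.
move=> x0; rewrite -[LHS]mulr1 -(det_block3_rot F 3) -det_mulmx mul_block3.
rewrite !(mulmx0, mulmx1, mulmxN, mul0mx, addr0, add0r) oppr0.
rewrite block3E det_block_scalar // mul_col_row !(mul0mx, mulmx0).
rewrite scale_block_mx !scaler0 opp_block_mx oppr0 add_block_mx !addr0 add0r.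
have -> : - (x 3)%:M = (- x 3)%:M :> 'M[F]_3 by rewrite raddfN.
rewrite det_block33_scalar ?oppr_eq0 // -detZ; congr (\det _).
rewrite mulNmx opprK scalerN scaleNr opprK scalerDr -!(scalemxAl, scalemxAr).
by rewrite !scalerA; congr (_ *: _ + _ *: _); field.
Qed.

End Schur3.

(** * The invariants h and q *)

Lemma qE : q = (\det (block3 0 (tmx 0 0) (tmx 1 1) (tmx 3 0) 0 (tmx 2 2)
  (tmx 4 1) (tmx 5 2) 0 : 'M[{mpoly polyfun[6]}]_(3 + (3 + 3))))
  @_[multinom [tuple 2; 1; 2; 1; 2; 1]]%N.
Proof. by []. Qed.

Lemma hE : h = (\det (block_mx (tmx 1 1) (tmx 0 0) (tmx 0 0) (tmx 2 2)))
  @_[multinom [tuple 2; 2; 2]]%N.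
Proof. by []. Qed.

Lemma evalx_h A x :
  evalx A (\det (block_mx (tmx 1 1) (tmx 0 0) (tmx 0 0) (tmx 2 2) :
    'M[{mpoly polyfun[3]}]_(3 + 3))) x =
  \det (block_mx (x 1 *: A 1) (x 0 *: A 0) (x 0 *: A 0) (x 2 *: A 2)).
Proof.
rewrite evalx_det map_block_mx.
by congr (\det (block_mx _ _ _ _)); apply: map_tmx.
Qed.

Lemma block3_congr (R : nmodType) k (a b c d e f a' b' c' d' e' f' : 'M[R]_k) :
  a = a' -> b = b' -> c = c' -> d = d' -> e = e' -> f = f' ->
  block3 0 a b c 0 d e f 0 = block3 0 a' b' c' 0 d' e' f' 0.
Proof. by move=> -> -> -> -> -> ->. Qed.

Lemma evalx_q A x : evalx A (\det (block3 0 (tmx 0 0) (tmx 1 1) (tmx 3 0) 0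
    (tmx 2 2) (tmx 4 1) (tmx 5 2) 0 : 'M[{mpoly polyfun[6]}]_(3 + (3 + 3)))) x =
  \det (block3 0 (x 0 *: A 0) (x 1 *: A 1) (x 3 *: A 0) 0 (x 2 *: A 2)
          (x 4 *: A 1) (x 5 *: A 2) 0).
Proof.
rewrite evalx_det map_block3 map_mx0; apply: (congr1 determinant).
by apply: block3_congr; apply: map_tmx.
Qed.

Section RelativeInvariance.

Variables (g g' : 'M[rat]_3) (A : triple).
Let gA : triple := fun k => g *m A k *m g'.

Lemma eval_f_mul i j k :
  eval (f_ i j k) gA = (\det g * \det g') * eval (f_ i j k) A.
Proof.
apply: eval_mcoeffZ => x; rewrite !evalx_f.
have -> : \sum_s x s *: gA s = g *m (\sum_s x s *: A s) *m g'.
  rewrite mulmx_sumr mulmx_suml; apply: eq_bigr => s _.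
  by rewrite -scalemxAr -scalemxAl.
by rewrite !det_mulmx; ring.
Qed.

Lemma eval_h_mul : eval h gA = (\det g * \det g') ^+ 2 * eval h A.
Proof.
rewrite hE; apply: eval_mcoeffZ => x; rewrite !evalx_h.
rewrite (_ : block_mx _ _ _ _ = block_mx g 0 0 g *m block_mx (x 1 *: A 1)
    (x 0 *: A 0) (x 0 *: A 0) (x 2 *: A 2) *m block_mx g' 0 0 g').
  by rewrite !det_mulmx !det_lblock; ring.
rewrite !mulmx_block !(mul0mx, mulmx0, addr0, add0r).
by rewrite -!(scalemxAl, scalemxAr).
Qed.

Lemma eval_q_mul : eval q gA = (\det g * \det g') ^+ 3 * eval q A.
Proof.
rewrite qE; apply: eval_mcoeffZ => x; rewrite !evalx_q.
rewrite (_ : block3 _ _ _ _ _ _ _ _ _ = block3 g 0 0 0 g 0 0 0 g *m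
   block3 0 (x 0 *: A 0) (x 1 *: A 1) (x 3 *: A 0) 0 (x 2 *: A 2)
     (x 4 *: A 1) (x 5 *: A 2) 0 *m block3 g' 0 0 0 g' 0 0 0 g').
  by rewrite !det_mulmx !det_block3_diag; ring.
rewrite !mul_block3 !(mul0mx, mulmx0, addr0, add0r).
by rewrite -!(scalemxAl, scalemxAr).
Qed.

End RelativeInvariance.

Definition tri (B C D : 'M[rat]_3) : triple := fun k => nth 0 [:: B; C; D] k.

Lemma eval_ext (f : polyfun) A A' : A =1 A' -> eval f A = eval f A'.
Proof.
move=> AA'; apply: meval_eq => s; rewrite /coords.
by congr (mxvec _ 0 s); apply/matrixP => i j; rewrite !mxE AA'.
Qed.

Lemma prod_mnm6 (R : comNzRingType) (x : 'I_6 -> R) a b c d e f :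
  \prod_s x s ^+ [multinom [tuple a; b; c; d; e; f]] s =
  x 0 ^+ a * x 1 ^+ b * x 2 ^+ c * x 3 ^+ d * x 4 ^+ e * x 5 ^+ f.
Proof.
rewrite !big_ord_recl big_ord0 mulr1 !mulrA.
congr (x _ ^+ _ * x _ ^+ _ * x _ ^+ _ * x _ ^+ _ * x _ ^+ _ * x _ ^+ _);
  exact: val_inj.
Qed.

(** The substitution of x_1 x_2 and - x_0^2 in the two-variable expansion of the
    determinant keeps its four terms apart; h is the second one. *)
Lemma eval_h_pencil A (C D : 'M[rat]_3) :
  (forall x : 'I_3 -> rat, (forall i, x i != 0) ->
     \det (block_mx (x 1 *: A 1) (x 0 *: A 0) (x 0 *: A 0) (x 2 *: A 2)) =
     \det ((x 1 * x 2) *: C + (- x 0 ^+ 2) *: D)) ->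
  eval h A = - pol C D.
Proof.
move=> hA; rewrite hE; pose s := [:: (\det C, [multinom [tuple 0; 3; 3]]%N);
  (- pol C D, [multinom [tuple 2; 2; 2]]%N); (pol D C, [multinom [tuple 4; 1; 1]]%N);
  (- \det D, [multinom [tuple 6; 0; 0]]%N)].
apply: (@eval_mcoeff _ _ _ s (- pol C D, _)) => //.
  exact: (@mem_nth _ (0, 0%MM) s 1).
move=> x x0; rewrite evalx_h hA // det_pencil.
rewrite !big_cons big_nil /= !prod_mnm3.
by rewrite ?expr0 ?expr1; ring.
Qed.

Lemma eval_q_pencil A (C D : 'M[rat]_3) :
  (forall x : 'I_6 -> rat, (forall i, x i != 0) ->
     \det (block3 0 (x 0 *: A 0) (x 1 *: A 1) (x 3 *: A 0) 0 (x 2 *: A 2)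
             (x 4 *: A 1) (x 5 *: A 2) 0) =
     \det ((x 0 * x 2 * x 4) *: C + (x 1 * x 3 * x 5) *: D)) ->
  eval q A = pol C D.
Proof.
move=> qA; rewrite qE.
pose s := [:: (\det C, [multinom [tuple 3; 0; 3; 0; 3; 0]]%N);
  (pol C D, [multinom [tuple 2; 1; 2; 1; 2; 1]]%N);
  (pol D C, [multinom [tuple 1; 2; 1; 2; 1; 2]]%N);
  (\det D, [multinom [tuple 0; 3; 0; 3; 0; 3]]%N)].
apply: (@eval_mcoeff _ _ _ s (pol C D, _)) => //.
  exact: (@mem_nth _ (0, 0%MM) s 1).
move=> x x0; rewrite evalx_q qA // det_pencil.
rewrite !big_cons big_nil /= !prod_mnm6.
by rewrite ?expr0 ?expr1; ring.
Qed.

(** Elimination of the off-diagonal identity blocks leaves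
    det (x_1 x_2 CB - x_0^2). *)
Lemma eval_h1 B C : eval h (tri 1%:M B C) = - pol (C *m B) 1%:M.
Proof.
apply: eval_h_pencil => x x0 /=.
rewrite scale_scalar_mx mulr1 det_block33_offdiag //.
rewrite -scalemxAl -scalemxAr scalerA scale_scalar_mx mulr1 raddfN.
by rewrite [x 2 * _]mulrC.
Qed.

(** Here the identity is the corner block. *)
Lemma eval_h1' B C : eval h (tri B 1%:M C) = - pol C (B *m B).
Proof.
apply: eval_h_pencil => x x0 /=.
rewrite scale_scalar_mx mulr1 det_block33_scalar //.
by rewrite -scalemxAl -scalemxAr !scalerA scaleNr.
Qed.

(** Elimination of the identity blocks leaves
    det (x_0 x_2 x_4 BC + x_1 x_3 x_5 CB). *)
Lemma eval_q1 B C : eval q (tri 1%:M B C) = pol (B *m C) (C *m B).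
Proof.
apply: eval_q_pencil => x x0 /=.
rewrite !scale_scalar_mx !mulr1 det_block3_offdiag //.
by rewrite addrC.
Qed.

(** Exchanging the last two block indices puts A_1 where A_0 was, with the
    outer variables permuted accordingly. *)
Lemma eval_q1' B C : eval q (tri B 1%:M C) = pol (C *m B) (B *m C).
Proof.
apply: eval_q_pencil => x x0 /=.
pose y (i : 'I_6) := x (tnth [tuple 1; 0; 5; 4; 3; 2] i).
rewrite det_block3_swap !scale_scalar_mx !mulr1.
rewrite (det_block3_offdiag (x := y)) => [|i]; last exact: x0.
by rewrite /y /=; congr (\det (_ *: _ + _ *: _)); ring.
Qed.

(** * Generation of SL_3 by transvections *)

Lemma forall_I3 (P : 'I_3 -> Prop) : P 0 -> P 1 -> P 2 -> forall i, P i.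
Proof.
move=> P0 P1 P2 [[|[|[|//]]] lt]; [move: P0|move: P1|move: P2];
  by congr P; apply: val_inj.
Qed.

Section SL3.

Variable F : fieldType.
Implicit Types (g : 'M[F]_3) (i j : 'I_3).

Definition transvection i j t : 'M[F]_3 := 1%:M + t *: delta_mx i j.

Lemma mx3P (R : Type) (B C : 'M[R]_3) :
  [/\ B 0 0 = C 0 0, B 0 1 = C 0 1 & B 0 2 = C 0 2] ->
  [/\ B 1 0 = C 1 0, B 1 1 = C 1 1 & B 1 2 = C 1 2] ->
  [/\ B 2 0 = C 2 0, B 2 1 = C 2 1 & B 2 2 = C 2 2] -> B = C.
Proof.
move=> [? ? ?] [? ? ?] [? ? ?]; apply/matrixP.
by apply: forall_I3; apply: forall_I3.
Qed.

(** Gaussian elimination: after a row operation that makes the entry (1,0)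
    nonzero, another one produces a pivot 1, which clears its row and column;
    the remaining 2 x 2 block, with c != 0 after a row operation, is
    [a b; c d] = [1 (a-1)/c; 0 1] [1 0; c 1] [1 (d-1)/c; 0 1]. *)
Lemma SL3_ind (P : 'M[F]_3 -> Prop) :
  (forall i j t, i != j -> P (transvection i j t)) ->
  (forall g1 g2, P g1 -> P g2 -> P (g1 *m g2)) ->
  forall g, \det g = 1 -> P g.
Proof.
move=> Pt Pm.
have tK i j t : i != j -> transvection i j t *m transvection i j (- t) = 1%:M.
  move=> ij; rewrite /transvection mulmxDl mulmxDr mulmxDr !mul1mx !mulmx1.
  rewrite -scalemxAl -scalemxAr mul_delta_mx_0 1?eq_sym // !scaler0 addr0.
  by rewrite scaleNr subrK.
have row_op g i j t : i != j -> P (transvection i j t *m g) -> P g.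
  move=> ij Pg; rewrite -[g]mul1mx -(tK i j (- t) ij) opprK -mulmxA.
  by apply: (Pm) => //; apply: (Pt).
have col_op g i j t : i != j -> P (g *m transvection i j t) -> P g.
  move=> ij Pg; rewrite -[g]mulmx1 -(tK i j t ij) mulmxA.
  by apply: (Pm) => //; apply: (Pt).
have det3 g : \det g = 1 -> _ = 1 := fun dg => etrans (esym (det3E g)) dg.
have PSL2 : forall g, \det g = 1 -> g 0 0 = 1 -> g 0 1 = 0 -> g 0 2 = 0 ->
    g 1 0 = 0 -> g 2 0 = 0 -> P g.
  have Pc g : \det g = 1 -> g 0 0 = 1 -> g 0 1 = 0 -> g 0 2 = 0 ->
      g 1 0 = 0 -> g 2 0 = 0 -> g 2 1 != 0 -> P g.
    move=> /det3 dg g00 g01 g02 g10 g20 g21.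
    have -> : g = transvection 1 2 ((g 1 1 - 1) / g 2 1) *m
        transvection 2 1 (g 2 1) *m transvection 1 2 ((g 2 2 - 1) / g 2 1).
      move: dg; rewrite g00 g01 g02 g10 g20 !mul0r subr0 addr0 mul1r => dg.
      have {}dg : g 1 2 = (g 1 1 * g 2 2 - 1) / g 2 1.
        by rewrite -dg; field.
      apply: mx3P; split; rewrite !mulmx3E !mxE /= ?g00 ?g01 ?g02 ?g10 ?g20 ?dg;
        by field.
    by do 2?apply: (Pm); apply: (Pt).
  move=> g dg g00 g01 g02 g10 g20.
  have [g21|g21] := eqVneq (g 2 1) 0; last exact: Pc.
  have g11 : g 1 1 != 0.
    apply/eqP => g11; have := det3 g dg; rewrite g01 g02 g11 g21.
    by move/eqP; rewrite !(mul0r, mulr0, subr0, addr0) eq_sym oner_eq0.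
  apply: (row_op g 2 1 1) => //; apply: Pc.
    by rewrite det_mulmx dg mulr1 det3E !mxE /=; ring.
  1-6: by rewrite mulmx3E !mxE /= ?g00 ?g01 ?g02 ?g10 ?g20 ?g21
            ?(mul0r, mulr0, mul1r, mulr1, add0r, addr0).
have P1r g : \det g = 1 -> g 0 0 = 1 -> g 0 1 = 0 -> g 1 0 = 0 -> g 2 0 = 0 -> P g.
  move=> dg g00 g01 g10 g20; apply: (col_op g 0 2 (- g 0 2)) => //; apply: PSL2.
    by rewrite det_mulmx dg mul1r det3E !mxE /=; ring.
  1-5: by rewrite mulmx3E !mxE /= ?g00 ?g01 ?g10 ?g20; ring.
have P1c g : \det g = 1 -> g 0 0 = 1 -> g 1 0 = 0 -> g 2 0 = 0 -> P g.
  move=> dg g00 g10 g20; apply: (col_op g 0 1 (- g 0 1)) => //; apply: P1r.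
    by rewrite det_mulmx dg mul1r det3E !mxE /=; ring.
  1-4: by rewrite mulmx3E !mxE /= ?g00 ?g10 ?g20; ring.
have P1d g : \det g = 1 -> g 0 0 = 1 -> g 1 0 = 0 -> P g.
  move=> dg g00 g10; apply: (row_op g 2 0 (- g 2 0)) => //; apply: P1c.
    by rewrite det_mulmx dg mulr1 det3E !mxE /=; ring.
  1-3: by rewrite mulmx3E !mxE /= ?g00 ?g10; ring.
have P1 g : \det g = 1 -> g 0 0 = 1 -> P g.
  move=> dg g00; apply: (row_op g 1 0 (- g 1 0)) => //; apply: P1d.
    by rewrite det_mulmx dg mulr1 det3E !mxE /=; ring.
  1-2: by rewrite mulmx3E !mxE /= ?g00; ring.
have P10 g : \det g = 1 -> g 1 0 != 0 -> P g.
  move=> dg g10; apply: (row_op g 0 1 ((1 - g 0 0) / g 1 0)) => //; apply: P1.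
    by rewrite det_mulmx dg mulr1 det3E !mxE /=; ring.
  by rewrite mulmx3E !mxE /=; field.
move=> g dg; have [g10|] := eqVneq (g 1 0) 0; last exact: P10.
have [g20|g20] := eqVneq (g 2 0) 0.
  have g00 : g 0 0 != 0.
    apply/eqP => g00; have := det3 g dg; rewrite g00 g10 g20.
    by move/eqP; rewrite !(mul0r, mulr0, subr0, addr0) eq_sym oner_eq0.
  apply: (row_op g 1 0 1) => //; apply: P10.
    by rewrite det_mulmx dg mulr1 det3E !mxE /=; ring.
  by rewrite mulmx3E !mxE /= g10 g20 !(mul0r, mulr0, mul1r, addr0, add0r).
apply: (row_op g 1 2 1) => //; apply: P10.
  by rewrite det_mulmx dg mulr1 det3E !mxE /=; ring.
by rewrite mulmx3E !mxE /= g10 !(mul0r, mulr0, mul1r, addr0, add0r).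
Qed.

End SL3.

(** * Explicit 3 x 3 matrices *)

Section Mx3.

Variable R : comNzRingType.
Implicit Types a b c d e f g h i x t : R.

Definition mx3 a b c d e f g h i : 'M[R]_3 :=
  \matrix_(k, l) nth 0 (nth [::] [:: [:: a; b; c]; [:: d; e; f]; [:: g; h; i]] k) l.

Lemma mx3_eta (B : 'M[R]_3) :
  B = mx3 (B 0 0) (B 0 1) (B 0 2) (B 1 0) (B 1 1) (B 1 2) (B 2 0) (B 2 1) (B 2 2).
Proof. by apply: mx3P; split; rewrite mxE. Qed.

Lemma scalar_mx3 t : t%:M = mx3 t 0 0 0 t 0 0 0 t.
Proof. by apply: mx3P; split; rewrite !mxE. Qed.

Lemma scale_mx3 t a b c d e f g h i : t *: mx3 a b c d e f g h i =
  mx3 (t * a) (t * b) (t * c) (t * d) (t * e) (t * f) (t * g) (t * h) (t * i).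
Proof. by apply: mx3P; split; rewrite !mxE. Qed.

Lemma add_mx3 a b c d e f g h i a' b' c' d' e' f' g' h' i' :
  mx3 a b c d e f g h i + mx3 a' b' c' d' e' f' g' h' i' =
  mx3 (a + a') (b + b') (c + c') (d + d') (e + e') (f + f') (g + g') (h + h') (i + i').
Proof. by apply: mx3P; split; rewrite !mxE. Qed.

Lemma mul_mx3 a b c d e f g h i a' b' c' d' e' f' g' h' i' :
  mx3 a b c d e f g h i *m mx3 a' b' c' d' e' f' g' h' i' =
  mx3 (a * a' + b * d' + c * g') (a * b' + b * e' + c * h') (a * c' + b * f' + c * i')
      (d * a' + e * d' + f * g') (d * b' + e * e' + f * h') (d * c' + e * f' + f * i')
      (g * a' + h * d' + i * g') (g * b' + h * e' + i * h') (g * c' + h * f' + i * i').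
Proof. by apply: mx3P; split; rewrite mulmx3E !mxE. Qed.

Lemma det_mx3 a b c d e f g h i : \det (mx3 a b c d e f g h i) =
  a * (e * i - f * h) - b * (d * i - f * g) + c * (d * h - e * g).
Proof. by rewrite det3E !mxE. Qed.

Lemma pol_mx3 a b c d e f g h i a' b' c' d' e' f' g' h' i' :
  pol (mx3 a b c d e f g h i) (mx3 a' b' c' d' e' f' g' h' i') =
    a' * (e * i - f * h) - b' * (d * i - f * g) + c' * (d * h - e * g)
  - d' * (b * i - c * h) + e' * (a * i - c * g) - f' * (a * h - b * g)
  + g' * (b * f - c * e) - h' * (a * f - c * d) + i' * (a * e - b * d).
Proof. by rewrite /pol !mxE. Qed.

Definition mx3E := (scalar_mx3, scale_mx3, add_mx3, mul_mx3, det_mx3, pol_mx3).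

End Mx3.

(** * Criterion for invariance under the mixing action *)

Lemma coordsE A k i j : coords A (mxvec_index k (mxvec_index i j)) = A k i j.
Proof. by rewrite /coords mxvecE mxE mxvecE. Qed.

Lemma index3P (P : 'I_(3 * (3 * 3)) -> Prop) :
  (forall k i j, P (mxvec_index k (mxvec_index i j))) -> forall s, P s.
Proof. by move=> Pk s; case/mxvec_indexP: s => k l; case/mxvec_indexP: l. Qed.

(* f as a polynomial in the entries of a family of matrices *)
Definition subst_mx n (f : polyfun) (G : 'I_3 -> 'M[{mpoly rat[n]}]_3) :
    {mpoly rat[n]} :=
  f \mPo [tuple mxvec (\matrix_(k < 3) mxvec (G k)) 0 s | s < 3 * (3 * 3)].

Lemma meval_subst_mx n f (G : 'I_3 -> 'M[{mpoly rat[n]}]_3) x :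
  (subst_mx f G).@[x] = eval f (fun k => map_mx (meval x) (G k)).
Proof.
rewrite comp_mpoly_meval; apply: meval_eq; apply: index3P => k i j.
by rewrite tnth_mktuple coordsE !(mxvecE, mxE).
Qed.

Lemma map_genmx A k : map_mx (meval (coords A)) (Defs.genmx k) = A k.
Proof. by apply/matrixP => i j; rewrite !mxE mevalXU coordsE. Qed.

Lemma map_ract n (G : 'I_3 -> 'M[{mpoly rat[n]}]_3) x (g : 'M[rat]_3) k :
  map_mx (meval x) (\sum_i (g i k)%:MP *: G i) =
  ract (fun i => map_mx (meval x) (G i)) g k.
Proof.
rewrite /ract map_mx_sum; apply: eq_bigr => i _.
by rewrite map_mxZ /= mevalC.
Qed.

Lemma ractM A g g' : ract (ract A g) g' =1 ract A (g *m g').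
Proof.
move=> k; rewrite /ract; under eq_bigr => j _ do rewrite scaler_sumr.
rewrite exchange_big; apply: eq_bigr => i _ /=; rewrite mxE scaler_suml.
by apply: eq_bigr => j _; rewrite scalerA mulrC.
Qed.

Lemma ract_mul A g a a' :
  ract (fun k => a *m A k *m a') g =1 fun k => a *m ract A g k *m a'.
Proof.
move=> k; rewrite /ract mulmx_sumr mulmx_suml; apply: eq_bigr => i _.
by rewrite -scalemxAr -scalemxAl.
Qed.

(** Relative invariance under both copies of GL_3, of weight d.  Asked for all
    g and g', it makes it possible to factor out A_0. *)
Definition rel_inv (d : nat) (f : polyfun) := forall g g' A,
  eval f (fun k => g *m A k *m g') = (\det g * \det g') ^+ d * eval f A.

Lemma rel_inv_inR d f : rel_inv d f -> inR f.
Proof.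
move=> fd g g' dg dg' A; rewrite fd det_inv dg dg' invr1 mulr1.
by rewrite expr1n mul1r.
Qed.

(** If det A_0 != 0, then A is A_0 times the triple (I, A_0^-1 A_1, A_0^-1 A_2),
    and left multiplication commutes with the mixing action. *)
Lemma rel_inv_ract d f g c : rel_inv d f ->
  (forall B C, eval f (ract (tri 1%:M B C) g) = c * eval f (tri 1%:M B C)) ->
  forall A, eval f (ract A g) = c * eval f A.
Proof.
move=> fd fg A.
pose F := subst_mx f (fun k => \sum_i (g i k)%:MP *: Defs.genmx i).
have FE A' : F.@[coords A'] = eval f (ract A' g).
  rewrite meval_subst_mx; apply: eval_ext => k; rewrite map_ract.
  by apply: eq_bigr => i _; rewrite map_genmx.
have coordsK x : coords (fun k => map_mx (meval x) (Defs.genmx k)) =1 x.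
  by apply: index3P => k i j; rewrite coordsE !mxE mevalXU.
have dE A' : (\det (Defs.genmx 0)).@[coords A'] = \det (A' 0).
  by rewrite -(map_genmx A') det_map_mx.
suff FcE : F = c *: f by rewrite -FE FcE mevalZ.
apply: (@meval_dense _ _ _ _ (\det (Defs.genmx 0))) => [|x].
  apply/eqP => /(congr1 (meval (coords (tri 1%:M 0 0)))).
  by rewrite dE det1 meval0 => /eqP; rewrite oner_eq0.
rewrite -!(meval_eq _ (coordsK x)); set A' := fun k => _.
rewrite mevalZ FE dE -/(eval _ _) => dA.
have AE : A' =1 fun k => A' 0 *m tri 1%:M (invmx (A' 0) *m A' 1)
    (invmx (A' 0) *m A' 2) k *m 1%:M.
  by apply: forall_I3; rewrite /= mulmx1 ?mulmx1 // mulKVmx // unitmxE unitfE.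
rewrite (eval_ext f AE) fd mulrCA -fg.
rewrite -fd; apply: eval_ext => k; rewrite -ract_mul.
by apply: eq_bigr => i _; rewrite AE.
Qed.

Lemma ract_transvection A i j t k : i != j ->
  ract A (transvection i j t) k = if k == j then A j + t *: A i else A k.
Proof.
move=> ij; rewrite /ract /transvection.
under eq_bigr => l _ do rewrite !mxE scalerDl.
rewrite big_split /= (bigD1 k) //= eqxx scale1r big1 => [|l /negPf ->]; last first.
  by rewrite scale0r.
rewrite addr0; have [->|kj] := eqVneq k j; last first.
  by rewrite big1 ?addr0 // => l _; rewrite andbF mulr0 scale0r.
congr (_ + _); rewrite (bigD1 i) //= eqxx big1 => [|l /negPf ->].
  by rewrite addr0 mulr1.
by rewrite mulr0 scale0r.
Qed.

(** This has determinant -1, so that an invariant may change sign under it. *)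
Definition swap01 : 'M[rat]_3 := \matrix_(i, j) (nth 0 [:: 1; 0; 2] i == j)%:R.

Lemma ract_swap01 A : ract A swap01 =1 tri (A 1) (A 0) (A 2).
Proof.
by apply: forall_I3; rewrite /ract sum3E !mxE /= !(scale0r, scale1r, add0r, addr0).
Qed.

(** The transvections which add to A_0 a multiple of another matrix would
    destroy the form (I, B, C); they are the conjugates under the exchange of
    A_0 and A_1 of those which change A_1. *)
Lemma rel_inv_inRSL d f c : rel_inv d f -> c * c = 1 ->
  (forall B C t, eval f (tri 1%:M (B + t%:M) C) = eval f (tri 1%:M B C)) ->
  (forall B C t, eval f (tri 1%:M B (C + t%:M)) = eval f (tri 1%:M B C)) ->
  (forall B C t, eval f (tri 1%:M (B + t *: C) C) = eval f (tri 1%:M B C)) ->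
  (forall B C t, eval f (tri 1%:M B (C + t *: B)) = eval f (tri 1%:M B C)) ->
  (forall B C, eval f (tri B 1%:M C) = c * eval f (tri 1%:M B C)) ->
  inRSL f.
Proof.
move=> fd cc f01 f02 f21 f12 fs; split; first exact: rel_inv_inR fd.
have swapE A : eval f (ract A swap01) = c * eval f A.
  apply: rel_inv_ract fd _ A => B C; rewrite -fs; apply: eval_ext.
  exact: ract_swap01.
have fix0 i j t : i != j -> j != 0 -> forall A,
    eval f (ract A (transvection i j t)) = eval f A.
  move=> ij j0 A; rewrite -[RHS]mul1r; apply: rel_inv_ract fd _ A => B C.
  rewrite mul1r.
  have [[-> ->]|[-> ->]|[-> ->]|[-> ->]] : [\/ i = 0 /\ j = 1, i = 0 /\ j = 2,
      i = 1 /\ j = 2 | i = 2 /\ j = 1].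
    move: i j ij j0; apply: forall_I3; apply: forall_I3 => // _ _;
      [exact: Or41|exact: Or42|exact: Or43|exact: Or44].
  - rewrite -(f01 _ _ t); apply: eval_ext; apply: forall_I3;
      by rewrite ract_transvection // -[t%:M]scalemx1.
  - rewrite -(f02 _ _ t); apply: eval_ext; apply: forall_I3;
      by rewrite ract_transvection // -[t%:M]scalemx1.
  - by rewrite -(f12 _ _ t); apply: eval_ext; apply: forall_I3;
      rewrite ract_transvection.
  - by rewrite -(f21 _ _ t); apply: eval_ext; apply: forall_I3;
      rewrite ract_transvection.
apply: SL3_ind => [i j t ij A|g1 g2 Pg1 Pg2 A]; last first.
  by rewrite -(eval_ext _ (ractM A g1 g2)) Pg2 Pg1.
have [j0|] := eqVneq j 0; last by move=> j0; apply: fix0.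
pose i' : 'I_3 := nth 0 [:: 1; 0; 2] i.
have i1 : i' != 1 by rewrite j0 in ij; move: i ij @i'; apply: forall_I3.
have <- : eval f (ract (ract (ract A swap01) (transvection i' 1 t)) swap01)
    = eval f (ract A (transvection i j t)).
  apply: eval_ext; rewrite j0 in ij *; apply: forall_I3;
    rewrite ract_swap01 /= !ract_transvection //= !ract_swap01 //=.
  by congr (_ + _ *: _); move: i ij @i' i1; apply: forall_I3.
by rewrite swapE fix0 // swapE mulrA cc mul1r.
Qed.

Lemma rel_inv_h : rel_inv 2 h.
Proof. by move=> g g' A; rewrite eval_h_mul. Qed.

Lemma rel_inv_q : rel_inv 3 q.
Proof. by move=> g g' A; rewrite eval_q_mul. Qed.

(** * Invariance of H and Q *)

(** H and Q as functions of the values of the f_, h and q.  Together with the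
    congruence lemmas they keep the determinants of polynomial matrices inside
    f_, h and q from being compared up to conversion. *)
Definition H_form (h f210 f012 f201 f021 f120 f102 f111 : rat) : rat :=
  h - 1 / 3 * (f210 * f012) - 1 / 3 * (f201 * f021) + 2 / 3 * (f120 * f102)
  + 1 / 12 * f111 ^+ 2.

Definition Q_form (q h f111 f300 f030 f003 f021 f012 f201 f102 f210 f120 : rat) : rat :=
  q - 1 / 2 * (h * f111) + 3 / 2 * (f300 * f030 * f003)
  - 1 / 2 * (f300 * f021 * f012) - 1 / 2 * (f030 * f201 * f102)
  - 1 / 2 * (f003 * f210 * f120) - 1 / 2 * (f111 * f120 * f102)
  + 1 / 2 * (f210 * f102 * f021) + 1 / 2 * (f120 * f201 * f012).

Lemma H_form_congr a b c d e u v w a' b' c' d' e' u' v' w' :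
  a = a' -> b = b' -> c = c' -> d = d' -> e = e' -> u = u' -> v = v' -> w = w' ->
  H_form a b c d e u v w = H_form a' b' c' d' e' u' v' w'.
Proof. by do 8!move=> ->. Qed.

Lemma Q_form_congr a b c d e u v w x y z t a' b' c' d' e' u' v' w' x' y' z' t' :
  a = a' -> b = b' -> c = c' -> d = d' -> e = e' -> u = u' -> v = v' -> w = w' ->
  x = x' -> y = y' -> z = z' -> t = t' ->
  Q_form a b c d e u v w x y z t = Q_form a' b' c' d' e' u' v' w' x' y' z' t'.
Proof. by do 12!move=> ->. Qed.

Lemma eval_H A : eval H A = H_form (eval h A) (eval (f_ 2 1 0) A)
  (eval (f_ 0 1 2) A) (eval (f_ 2 0 1) A) (eval (f_ 0 2 1) A) (eval (f_ 1 2 0) A)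
  (eval (f_ 1 0 2) A) (eval (f_ 1 1 1) A).
Proof.
have gen (a b c d e u v w : polyfun) :
  eval (a - (1 / 3) *: (b * c) - (1 / 3) *: (d * e) + (2 / 3) *: (u * v)
        + (1 / 12) *: w ^+ 2) A
  = H_form (eval a A) (eval b A) (eval c A) (eval d A) (eval e A) (eval u A)
      (eval v A) (eval w A).
  by rewrite /eval !(mevalD, mevalN, mevalZ, mevalM).
exact: gen.
Qed.

Lemma eval_Q A : eval Q A = Q_form (eval q A) (eval h A) (eval (f_ 1 1 1) A)
  (eval (f_ 3 0 0) A) (eval (f_ 0 3 0) A) (eval (f_ 0 0 3) A) (eval (f_ 0 2 1) A)
  (eval (f_ 0 1 2) A) (eval (f_ 2 0 1) A) (eval (f_ 1 0 2) A) (eval (f_ 2 1 0) A)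
  (eval (f_ 1 2 0) A).
Proof.
have gen (a b c d e u v w k l x z : polyfun) :
  eval (a - (1 / 2) *: (b * c) + (3 / 2) *: (d * e * u) - (1 / 2) *: (d * v * w)
        - (1 / 2) *: (e * k * l) - (1 / 2) *: (u * x * z) - (1 / 2) *: (c * z * l)
        + (1 / 2) *: (x * l * v) + (1 / 2) *: (z * k * w)) A
  = Q_form (eval a A) (eval b A) (eval c A) (eval d A) (eval e A) (eval u A)
      (eval v A) (eval w A) (eval k A) (eval l A) (eval x A) (eval z A).
  by rewrite /eval !(mevalD, mevalN, mevalZ, mevalM).
exact: gen.
Qed.

Lemma rel_inv_H : rel_inv 2 H.
Proof.
move=> g g' A; set s := \det g * \det g'.
have scale (a b c d e u v w : rat) : H_form (s ^+ 2 * a) (s * b) (s * c) (s * d)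
    (s * e) (s * u) (s * v) (s * w) = s ^+ 2 * H_form a b c d e u v w.
  by rewrite /H_form; ring.
rewrite (eval_H A) (eval_H (fun k => _)) -scale.
by apply: H_form_congr; [exact: rel_inv_h | exact: eval_f_mul..].
Qed.

Lemma rel_inv_Q : rel_inv 3 Q.
Proof.
move=> g g' A; set s := \det g * \det g'.
have scale (a b c d e u v w x y z t : rat) : Q_form (s ^+ 3 * a) (s ^+ 2 * b)
    (s * c) (s * d) (s * e) (s * u) (s * v) (s * w) (s * x) (s * y) (s * z) (s * t)
    = s ^+ 3 * Q_form a b c d e u v w x y z t.
  by rewrite /Q_form; ring.
rewrite (eval_Q A) (eval_Q (fun k => _)) -scale.
by apply: Q_form_congr; [exact: rel_inv_q | exact: rel_inv_h | exact: eval_f_mul..].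
Qed.

Lemma eval_H_tri B C D : eval H (tri B C D) = H_form (eval h (tri B C D))
  (pol B C) (pol D C) (pol B D) (pol C D) (pol C B) (pol D B) (pol3 B C D).
Proof.
have [_ [? ? ? ?] [? ? ?]] := eval_fE (tri B C D).
rewrite eval_H; exact: H_form_congr.
Qed.

Lemma eval_Q_tri B C D : eval Q (tri B C D) = Q_form (eval q (tri B C D))
  (eval h (tri B C D)) (pol3 B C D) (\det B) (\det C) (\det D)
  (pol C D) (pol D C) (pol B D) (pol D B) (pol B C) (pol C B).
Proof.
have [[? ? ?] [? ? ? ?] [? ? ?]] := eval_fE (tri B C D).
rewrite eval_Q; exact: Q_form_congr.
Qed.

Lemma inRSL_H : inRSL H.
Proof.
apply: (rel_inv_inRSL (c := 1) rel_inv_H); first exact: mulr1.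
1-4: move=> B C t; rewrite (mx3_eta B) (mx3_eta C) !eval_H_tri !eval_h1.
1-4: by rewrite /H_form /pol3 !mx3E; field.
move=> B C; rewrite (mx3_eta B) (mx3_eta C) !eval_H_tri eval_h1 eval_h1'.
by rewrite /H_form /pol3 !mx3E; field.
Qed.

(** Under GL_3 an invariant of degree 9 is multiplied by det^3, whence the sign
    for the exchange of A_0 and A_1. *)
Lemma inRSL_Q : inRSL Q.
Proof.
apply: (rel_inv_inRSL (c := -1) rel_inv_Q); first by rewrite mulrNN mulr1.
1-4: move=> B C t; rewrite (mx3_eta B) (mx3_eta C) !eval_Q_tri !eval_h1 !eval_q1.
1-4: by rewrite /Q_form /pol3 !mx3E; field.
move=> B C; rewrite (mx3_eta B) (mx3_eta C) !eval_Q_tri.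
rewrite eval_h1 eval_h1' eval_q1 eval_q1'.
by rewrite /Q_form /pol3 !mx3E; field.
Qed.

(** * Tangent vectors of the orbits *)

Definition entries (A : triple) : 'M[rat]_(3, 3 * 3) := \matrix_k mxvec (A k).

Definition uncoords (x : 'I_(3 * (3 * 3)) -> rat) : triple :=
  fun k => \matrix_(i, j) x (mxvec_index k (mxvec_index i j)).

Lemma uncoordsK x : coords (uncoords x) =1 x.
Proof. by apply: index3P => k i j; rewrite coordsE mxE. Qed.

Definition add_triple (A B : triple) t : triple := fun k => A k + t *: B k.

Lemma coords_add A B t :
  coords (add_triple A B t) =1 fun s => coords A s + t * coords B s.
Proof. by apply: index3P => k i j; rewrite !coordsE !mxE. Qed.

(** The infinitesimal actions multiply the 3 x 9 matrix of all entries by a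
    matrix on either side; the point is that they are linear in the 27
    coordinates. *)
Lemma entries_op (U : 'M[rat]_3) (V : 'M[rat]_(3 * 3)) (X : triple -> triple) :
  (forall A, U *m (entries A *m V) = entries (X A)) ->
  exists M : 'M[rat]_(3 * (3 * 3)), forall A s,
    \sum_j M s j * coords A j = coords (X A) s.
Proof.
move=> UV; exists (lin_mx (mulmx U \o mulmxr V))^T => A s.
rewrite /coords -/(entries A) -/(entries (X A)) -UV.
rewrite -[U *m _]/((mulmx U \o mulmxr V) (entries A)).
rewrite -mul_vec_lin [RHS]mxE; apply: eq_bigr => j _.
by rewrite mxE mulrC.
Qed.

Definition unipotent (N : 'M[rat]_3) := forall t, \det (1%:M + t *: N) = 1.

(** X is a linear vector field, and f is constant on the lines tangent to it.
    Lie algebra elements N with 1 + tN in SL_3 for all t give such X. *)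
Definition tangent_op (f : polyfun) (X : triple -> triple) :=
  (exists M : 'M[rat]_(3 * (3 * 3)), forall A s,
     \sum_j M s j * coords A j = coords (X A) s) /\
  (forall A t, eval f (add_triple A (X A) t) = eval f A).

Section TangentOps.

Variables (f : polyfun) (N : 'M[rat]_3).
Hypotheses (fG : inRSL f) (N1 : unipotent N).

Lemma tangent_left : tangent_op f (fun A k => N *m A k).
Proof.
split=> [|A t].
  apply: (@entries_op 1%:M (lin_mx (mulmx N))) => A; apply/row_matrixP => k.
  by rewrite mul1mx row_mul !rowK mul_vec_lin.
rewrite -[RHS]((fG.1 _ _ (N1 t) (det1 _ _)) A); apply: eval_ext => k.
by rewrite /add_triple invmx1 mulmx1 mulmxDl mul1mx scalemxAl.
Qed.

Lemma tangent_right : tangent_op f (fun A k => A k *m N).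
Proof.
split=> [|A t].
  apply: (@entries_op 1%:M (lin_mx (mulmxr N))) => A; apply/row_matrixP => k.
  by rewrite mul1mx row_mul !rowK mul_vec_lin.
have dN : \det (invmx (1%:M + t *: N)) = 1 by rewrite det_inv N1 invr1.
rewrite -[RHS](fG.1 _ _ (det1 _ _) dN A); apply: eval_ext => k.
by rewrite /add_triple invmxK mul1mx mulmxDr mulmx1 scalemxAr.
Qed.

Lemma tangent_mix : tangent_op f (ract^~ N).
Proof.
split=> [|A t].
  apply: (@entries_op N^T 1%:M) => A; apply/row_matrixP => k.
  rewrite mulmx1 rowK; apply/rowP => s.
  by rewrite !mxE linear_sum summxE; apply: eq_bigr => i _; rewrite linearZ !mxE.
rewrite -[RHS](fG.2 _ (N1 t) A); apply: eval_ext => k.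
rewrite /add_triple /ract.
under [RHS]eq_bigr => i _ do rewrite !mxE scalerDl.
rewrite big_split /= [X in _ = X + _](bigD1 k) //= eqxx scale1r
  [X in _ = _ + X + _]big1 ?addr0 => [|i /negPf ->].
  by rewrite scaler_sumr; congr (_ + _); apply: eq_bigr => i _; rewrite scalerA.
by rewrite scale0r.
Qed.

End TangentOps.

Definition pair_mx (B C : 'M[rat]_3) : rat := \sum_i \sum_j B i j * C i j.

Definition pair_triple (A W : triple) : rat :=
  pair_mx (A 0) (W 0) + pair_mx (A 1) (W 1) + pair_mx (A 2) (W 2).

Lemma sum_mxvec (V : nmodType) m n (F : 'I_(m * n) -> V) :
  \sum_s F s = \sum_i \sum_j F (mxvec_index i j).
Proof.
rewrite pair_bigA (reindex _ (curry_mxvec_bij _ _)) /=.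
by apply: eq_bigr => -[i j].
Qed.

Lemma sum_coords A (w : 'I_(3 * (3 * 3)) -> rat) :
  \sum_s coords A s * w s = pair_triple A (uncoords w).
Proof.
rewrite sum_mxvec sum3E; congr (_ + _ + _); rewrite sum_mxvec;
  by apply: eq_bigr => i _; apply: eq_bigr => j _; rewrite coordsE mxE.
Qed.

(** The slice principle, with triples in place of coordinate vectors. *)
Lemma slice_triple_eq0 f (P D : triple -> Prop) :
  (exists A, P A) ->
  (forall A B t, P A -> D B -> exists2 A', P A' & add_triple A B t =1 A') ->
  (forall A, P A -> forall W : triple,
     (forall X, tangent_op f X -> pair_triple (X A) W = 0) ->
     (forall B, D B -> pair_triple B W = 0) -> forall k, W k = 0) ->
  (forall A, P A -> eval f A = 0) -> f = 0.
Proof.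
move=> [A0 PA0] PD span f0.
apply: (@slice_eq0 _ _ _ (fun M => forall x t,
     f.@[fun i => x i + t * \sum_j M i j * x j] = f.@[x])
   (fun x => exists2 A, P A & x =1 coords A)
   (fun v => exists2 B, D B & v =1 coords B)) => //.
- by exists (coords A0), A0.
- move=> x v t [A PA xA] [B DB vB]; have [A' PA' A'E] := PD A B t PA DB.
  exists A' => // s; rewrite xA vB -coords_add.
  by rewrite /coords; congr (mxvec _ 0 s); apply/matrixP => i j; rewrite !mxE A'E.
- move=> x [A PA xA] w wX wD; apply: index3P => k i j.
  have /(_ k)/matrixP/(_ i j) : forall k, uncoords w k = 0.
    apply: (span A PA) => [X [[M MX] Xf]|B DB]; rewrite -sum_coords.
      rewrite -[RHS](wX M) => [|y t].
        apply: eq_bigr => s _; congr (_ * _); rewrite -MX.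
        by apply: eq_bigr => l _; rewrite xA.
      rewrite -(meval_eq _ (uncoordsK y)) -/(eval f _) -(Xf _ t).
      apply: meval_eq => s; rewrite coords_add uncoordsK -MX; congr (_ + _ * _).
      by apply: eq_bigr => l _; rewrite uncoordsK.
    by rewrite -[RHS](wD (coords B)) //; exists B.
  by rewrite !mxE.
- by move=> x [A PA xA]; rewrite (meval_eq _ xA); apply: f0.
Qed.

(** * The slice through the regular nilpotent triple *)

Section KostantSlice.

Definition shift3 : 'M[rat]_3 := mx3 0 1 0 0 0 1 0 0 0.

(** For a = b = c = 0 this is the regular nilpotent tensor: the weights
    of its six nonzero entries are simple roots of E_6.  Give the entry (i, j) of A_0, A_1, A_2
    the weight 3(j-i), 3(j-i) - 3 and 3(j-i) + 6, respectively; then these have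
    weight 0, while the entries a, b, c have weight 6, 9, 12. *)
Definition slice (a b c : rat) : triple := tri 1%:M shift3 (mx3 0 b c 0 a 0 1 0 0).

Lemma pair_mx3 a b c d e f g h i a' b' c' d' e' f' g' h' i' :
  pair_mx (mx3 a b c d e f g h i) (mx3 a' b' c' d' e' f' g' h' i') =
  a * a' + b * b' + c * c' + d * d' + e * e' + f * f' + g * g' + h * h' + i * i'.
Proof. by rewrite /pair_mx !sum3E !mxE /= !addrA. Qed.

Lemma ract_mx3 A a b c d e f g h i : ract A (mx3 a b c d e f g h i) =1
  tri (a *: A 0 + d *: A 1 + g *: A 2) (b *: A 0 + e *: A 1 + h *: A 2)
      (c *: A 0 + f *: A 1 + i *: A 2).
Proof. by apply: forall_I3; rewrite /ract sum3E !mxE. Qed.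

Lemma unipotent_mx3 a b c d e f g h i :
  (forall t, \det (mx3 (1 + t * a) (t * b) (t * c) (t * d) (1 + t * e) (t * f)
    (t * g) (t * h) (1 + t * i)) = 1) -> unipotent (mx3 a b c d e f g h i).
Proof. by move=> dt t; have := dt t; rewrite !mx3E !add0r. Qed.

(** The 27 unknowns W are orthogonal to the 24 tangent vectors given by
    sl_3 + sl_3 + sl_3 and to the 3 directions of the slice.  For the grading by
    weight the system is block triangular: a, b, c multiply unknowns of higher
    weight only, and the diagonal blocks, of size at most 6, are those of the
    nilpotent tensor. *)
Lemma transverse a b c (W : triple) f : inRSL f ->
  (forall X, tangent_op f X -> pair_triple (X (slice a b c)) W = 0) ->
  W 2 1 1 = 0 -> W 2 0 1 = 0 -> W 2 0 2 = 0 -> forall k, W k = 0.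
Proof.
move=> fG WX w211 w201 w202.
have sl0 : slice a b c 0 = mx3 1 0 0 0 1 0 0 0 1 by exact: scalar_mx3.
have sl1 : slice a b c 1 = shift3 by [].
have sl2 : slice a b c 2 = mx3 0 b c 0 a 0 1 0 0 by [].
(* The last two are diag(1,-1,0) and diag(0,1,-1) plus off-diagonal elements
   that make their square zero. *)
have U : [/\ [/\ unipotent (mx3 0 1 0 0 0 0 0 0 0),
      unipotent (mx3 0 0 1 0 0 0 0 0 0),
      unipotent (mx3 0 0 0 1 0 0 0 0 0) & unipotent (mx3 0 0 0 0 0 1 0 0 0)],
      [/\ unipotent (mx3 0 0 0 0 0 0 1 0 0), unipotent (mx3 0 0 0 0 0 0 0 1 0),
      unipotent (mx3 1 (-1) 0 1 (-1) 0 0 0 0) &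
      unipotent (mx3 0 0 0 0 1 (-1) 0 1 (-1))] & True].
  by split=> //; split; apply: unipotent_mx3 => t; rewrite det_mx3; ring.
case: U => [[U01 U02 U10 U12] [U20 U21 D01 D12] _].
(* L, R and T are the orthogonality to N A, A N and to the mixing by N. *)
have L d e g h i j k l m : unipotent (mx3 d e g h i j k l m) ->
    d * W 0 0 0 + e * W 0 0 1 + g * W 0 0 2 + h * W 0 1 0 + i * W 0 1 1 + j * W 0 1 2
    + k * W 0 2 0 + l * W 0 2 1 + m * W 0 2 2
    + d * W 1 0 1 + e * W 1 0 2 + h * W 1 1 1 + i * W 1 1 2 + k * W 1 2 1 + l * W 1 2 2
    + g * W 2 0 0 + d * (b * W 2 0 1 + c * W 2 0 2) + e * (a * W 2 0 1)
    + j * W 2 1 0 + h * (b * W 2 1 1 + c * W 2 1 2) + i * (a * W 2 1 1)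
    + m * W 2 2 0 + k * (b * W 2 2 1 + c * W 2 2 2) + l * (a * W 2 2 1) = 0.
  move=> N1; rewrite -[RHS](WX _ (tangent_left fG N1)) /pair_triple /=.
  rewrite sl0 sl1 sl2.
  rewrite (mx3_eta (W 0)) (mx3_eta (W 1)) (mx3_eta (W 2)) /= ?sl0 ?sl1 ?sl2.
  rewrite !mx3E !pair_mx3.
  by rewrite !mxE /=; ring.
have R d e g h i j k l m : unipotent (mx3 d e g h i j k l m) ->
    d * W 0 0 0 + e * W 0 0 1 + g * W 0 0 2 + h * W 0 1 0 + i * W 0 1 1 + j * W 0 1 2
    + k * W 0 2 0 + l * W 0 2 1 + m * W 0 2 2
    + h * W 1 0 0 + i * W 1 0 1 + j * W 1 0 2 + k * W 1 1 0 + l * W 1 1 1 + m * W 1 1 2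
    + (b * h + c * k) * W 2 0 0 + (b * i + c * l) * W 2 0 1 + (b * j + c * m) * W 2 0 2
    + a * h * W 2 1 0 + a * i * W 2 1 1 + a * j * W 2 1 2
    + d * W 2 2 0 + e * W 2 2 1 + g * W 2 2 2 = 0.
  move=> N1; rewrite -[RHS](WX _ (tangent_right fG N1)) /pair_triple /=.
  rewrite sl0 sl1 sl2.
  rewrite (mx3_eta (W 0)) (mx3_eta (W 1)) (mx3_eta (W 2)) /= ?sl0 ?sl1 ?sl2.
  rewrite !mx3E !pair_mx3.
  by rewrite !mxE /=; ring.
pose s0 k := W k 0 0 + W k 1 1 + W k 2 2.
pose s1 k := W k 0 1 + W k 1 2.
pose s2 k := b * W k 0 1 + c * W k 0 2 + a * W k 1 1 + W k 2 0.
have T d e g h i j k l m : unipotent (mx3 d e g h i j k l m) ->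
    d * s0 0 + e * s0 1 + g * s0 2 + h * s1 0 + i * s1 1 + j * s1 2
    + k * s2 0 + l * s2 1 + m * s2 2 = 0.
  move=> N1; rewrite -[RHS](WX _ (tangent_mix fG N1)) /pair_triple !ract_mx3.
  rewrite sl0 sl1 sl2.
  rewrite (mx3_eta (W 0)) (mx3_eta (W 1)) (mx3_eta (W 2)) /= ?sl0 ?sl1 ?sl2.
  rewrite !mx3E !pair_mx3.
  by rewrite /s0 /s1 /s2; ring.
have L01 : W 0 0 1 + W 1 0 2 = 0.
  move: (L _ _ _ _ _ _ _ _ _ U01);
    clear -w211 w201 w202; rewrite ?(w211, w201, w202); lra.
have L02 : W 0 0 2 + W 2 0 0 = 0.
  move: (L _ _ _ _ _ _ _ _ _ U02);
    clear -w211 w201 w202; rewrite ?(w211, w201, w202); lra.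
have L10 : W 0 1 0 + W 1 1 1 + c * W 2 1 2 = 0.
  move: (L _ _ _ _ _ _ _ _ _ U10);
    clear -w211 w201 w202; rewrite ?(w211, w201, w202); lra.
have L12 : W 0 1 2 + W 2 1 0 = 0.
  move: (L _ _ _ _ _ _ _ _ _ U12);
    clear -w211 w201 w202; rewrite ?(w211, w201, w202); lra.
have L20 : W 0 2 0 + W 1 2 1 + b * W 2 2 1 + c * W 2 2 2 = 0.
  move: (L _ _ _ _ _ _ _ _ _ U20);
    clear -w211 w201 w202; rewrite ?(w211, w201, w202); lra.
have L21 : W 0 2 1 + W 1 2 2 + a * W 2 2 1 = 0.
  move: (L _ _ _ _ _ _ _ _ _ U21);
    clear -w211 w201 w202; rewrite ?(w211, w201, w202); lra.
have LD01 : W 0 0 0 + W 1 0 1 = W 0 1 1 + W 1 1 2.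
  move: L01 L10 (L _ _ _ _ _ _ _ _ _ D01);
    clear -w211 w201 w202; rewrite !(w211, w201, w202); lra.
have LD12 : W 0 1 1 + W 1 1 2 = W 0 2 2 + W 2 2 0.
  move: L12 L21 (L _ _ _ _ _ _ _ _ _ D12);
    clear -w211 w201 w202; rewrite !(w211, w201, w202); lra.
have R01 : W 0 0 1 + W 2 2 1 = 0.
  move: (R _ _ _ _ _ _ _ _ _ U01);
    clear -w211 w201 w202; rewrite ?(w211, w201, w202); lra.
have R02 : W 0 0 2 + W 2 2 2 = 0.
  move: (R _ _ _ _ _ _ _ _ _ U02);
    clear -w211 w201 w202; rewrite ?(w211, w201, w202); lra.
have R10 : W 0 1 0 + W 1 0 0 + b * W 2 0 0 + a * W 2 1 0 = 0.
  move: (R _ _ _ _ _ _ _ _ _ U10);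
    clear -w211 w201 w202; rewrite ?(w211, w201, w202); lra.
have R12 : W 0 1 2 + W 1 0 2 + a * W 2 1 2 = 0.
  move: (R _ _ _ _ _ _ _ _ _ U12);
    clear -w211 w201 w202; rewrite ?(w211, w201, w202); lra.
have R20 : W 0 2 0 + W 1 1 0 + c * W 2 0 0 = 0.
  move: (R _ _ _ _ _ _ _ _ _ U20);
    clear -w211 w201 w202; rewrite ?(w211, w201, w202); lra.
have R21 : W 0 2 1 + W 1 1 1 = 0.
  move: (R _ _ _ _ _ _ _ _ _ U21);
    clear -w211 w201 w202; rewrite ?(w211, w201, w202); lra.
have RD01 : W 0 0 0 + W 2 2 0 = W 0 1 1 + W 1 0 1.
  move: R01 R10 (R _ _ _ _ _ _ _ _ _ D01);
    clear -w211 w201 w202; rewrite !(w211, w201, w202); lra.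
have RD12 : W 0 1 1 + W 1 0 1 = W 0 2 2 + W 1 1 2.
  move: R12 R21 (R _ _ _ _ _ _ _ _ _ D12);
    clear -w211 w201 w202; rewrite !(w211, w201, w202); lra.
have T01 : W 1 0 0 + W 1 1 1 + W 1 2 2 = 0.
  move: (T _ _ _ _ _ _ _ _ _ U01);
    clear -w211 w201 w202; rewrite /s0 /s1 /s2 ?(w211, w201, w202); lra.
have T02 : W 2 0 0 + W 2 2 2 = 0.
  move: (T _ _ _ _ _ _ _ _ _ U02);
    clear -w211 w201 w202; rewrite /s0 /s1 /s2 ?(w211, w201, w202); lra.
have T10 : W 0 0 1 + W 0 1 2 = 0.
  move: (T _ _ _ _ _ _ _ _ _ U10);
    clear -w211 w201 w202; rewrite /s0 /s1 /s2 ?(w211, w201, w202); lra.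
have T12 : W 2 1 2 = 0.
  move: (T _ _ _ _ _ _ _ _ _ U12);
    clear -w211 w201 w202; rewrite /s0 /s1 /s2 ?(w211, w201, w202); lra.
have T20 : b * W 0 0 1 + c * W 0 0 2 + a * W 0 1 1 + W 0 2 0 = 0.
  move: (T _ _ _ _ _ _ _ _ _ U20);
    clear -w211 w201 w202; rewrite /s0 /s1 /s2 ?(w211, w201, w202); lra.
have T21 : b * W 1 0 1 + c * W 1 0 2 + a * W 1 1 1 + W 1 2 0 = 0.
  move: (T _ _ _ _ _ _ _ _ _ U21);
    clear -w211 w201 w202; rewrite /s0 /s1 /s2 ?(w211, w201, w202); lra.
have TD01 : W 0 0 0 + W 0 1 1 + W 0 2 2 = W 1 0 1 + W 1 1 2.
  move: T01 T10 (T _ _ _ _ _ _ _ _ _ D01);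
    clear -w211 w201 w202; rewrite /s0 /s1 /s2 !(w211, w201, w202); lra.
have TD12 : W 1 0 1 + W 1 1 2 = W 2 2 0.
  move: T12 T21 (T _ _ _ _ _ _ _ _ _ D12);
    clear -w211 w201 w202; rewrite /s0 /s1 /s2 !(w211, w201, w202); lra.
(* W 2 1 2 = 0 is the weight 9; then follow the weights 6, 3, -3, 0, -6, -9. *)
clear -w211 w201 w202 L01 L02 L10 L12 L20 L21 LD01 LD12 R01 R02 R10 R12 R20 R21
  RD01 RD12 T01 T02 T10 T12 T20 T21 TD01 TD12.
have [w002 w200 w222] : [/\ W 0 0 2 = 0, W 2 0 0 = 0 & W 2 2 2 = 0].
  by clear -T02 L02 R02; split; lra.
rewrite T12 mulr0 addr0 in R12 L10.
have [w001 w102 w221 w012 w210] :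
    [/\ W 0 0 1 = 0, W 1 0 2 = 0, W 2 2 1 = 0, W 0 1 2 = 0 & W 2 1 0 = 0].
  by clear -L01 R01 R12 L12 T10; split; lra.
rewrite !(w200, w210, w221, w222, mulr0, addr0) in R10 L21 R20 L20.
have [w010 w111 w021 w122 w100] :
    [/\ W 0 1 0 = 0, W 1 1 1 = 0, W 0 2 1 = 0, W 1 2 2 = 0 & W 1 0 0 = 0].
  by clear -L10 L21 R21 R10 T01; split; lra.
have [[w000 w011 w022] [w101 w112 w220]] :
    [/\ W 0 0 0 = 0, W 0 1 1 = 0 & W 0 2 2 = 0] /\
    [/\ W 1 0 1 = 0, W 1 1 2 = 0 & W 2 2 0 = 0].
  by clear -LD01 LD12 RD01 RD12 TD01 TD12; split; split; lra.
rewrite !(w001, w002, w011, w101, w102, w111, mulr0, add0r) in T20 T21.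
rewrite T20 !add0r in R20 L20.
by apply: forall_I3; apply: mx3P; rewrite !mxE.
Qed.

Lemma slice_determines f : inRSL f -> (forall a b c, eval f (slice a b c) = 0) ->
  f = 0.
Proof.
move=> fG f0.
pose D (B : triple) := exists a b c, B = tri 0 0 (mx3 0 b c 0 a 0 0 0 0).
apply: (@slice_triple_eq0 f (fun A => exists a b c, A = slice a b c) D).
- by exists (slice 0 0 0), 0, 0, 0.
- move=> _ _ t [a [b [c ->]]] [a' [b' [c' ->]]].
  exists (slice (a + t * a') (b + t * b') (c + t * c')).
    by exists (a + t * a'), (b + t * b'), (c + t * c').
  rewrite /add_triple; apply: forall_I3; rewrite /= ?scaler0 ?addr0 //.
  by rewrite !mx3E; congr mx3; ring.
- move=> _ [a [b [c ->]]] W WX WD.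
  have WDE x y z : y * W 2 0 1 + z * W 2 0 2 + x * W 2 1 1 = 0.
    rewrite -[RHS](WD (tri 0 0 (mx3 0 y z 0 x 0 0 0 0))); last by exists x, y, z.
    rewrite /pair_triple (mx3_eta (W 2)) /= pair_mx3 !mxE /=.
    by rewrite /pair_mx; rewrite !big1 ?add0r => [|i _|i _]; [ring| |];
       rewrite big1 // => j _; rewrite !mxE mul0r.
  apply: (transverse fG WX).
  + by move: (WDE 1 0 0); lra.
  + by move: (WDE 0 1 0); lra.
  + by move: (WDE 0 0 1); lra.
- by move=> _ [a [b [c ->]]].
Qed.

End KostantSlice.

(** * Invariants of degree 6 and 9 *)

Lemma expr2_inj m n : (2 : rat) ^+ m = 2 ^+ n -> m = n.
Proof. by rewrite -!natrX => /eqP; rewrite eqr_nat eqn_exp2l // => /eqP. Qed.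

Lemma dhomog_eval d f A s : f \is d.-homog ->
  eval f (fun k => s *: A k) = s ^+ d * eval f A.
Proof.
move=> fd; rewrite /eval !mevalE big_distrr /= !big_seq; apply: eq_bigr => m mf.
rewrite mulrCA; congr (_ * _).
have <- : mdeg m = d := dhomog_mf fd mf.
rewrite mdegE -prodrXr -big_split /=; apply: eq_bigr => i _.
rewrite -exprMn; congr (_ ^+ _); move: i; apply: index3P => k i j.
by rewrite !coordsE mxE.
Qed.

(** The scalar matrix 2 has determinant 2^3. *)
Lemma rel_inv_dhomog d f : rel_inv d f -> f \is (3 * d).-homog.
Proof.
move=> fd; apply/dhomogP => m; rewrite mcoeff_msupp => fm.
have scal x : f.@[fun i => 2 * x i] = 2 ^+ (3 * d) * f.@[x].
  have <- : eval f (fun k => 2%:M *m uncoords x k *m 1%:M) = f.@[fun i => 2 * x i].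
    apply: meval_eq; apply: index3P => k i j.
    by rewrite coordsE mulmx1 mul_scalar_mx !mxE.
  rewrite fd det_scalar det1 mulr1 exprM; congr (_ * _).
  by apply: meval_eq; apply: uncoordsK.
have := mcoeff_scaling scal fm; rewrite prodrXr -mdegE; exact: expr2_inj.
Qed.

Lemma inRSLD f1 f2 : inRSL f1 -> inRSL f2 -> inRSL (f1 + f2).
Proof.
move=> [f1l f1r] [f2l f2r]; split=> [g g' dg dg' A|g dg A]; rewrite /eval !mevalD.
  by rewrite -!/(eval _ _) f1l // f2l.
by rewrite -!/(eval _ _) f1r // f2r.
Qed.

Lemma inRSLM f1 f2 : inRSL f1 -> inRSL f2 -> inRSL (f1 * f2).
Proof.
move=> [f1l f1r] [f2l f2r]; split=> [g g' dg dg' A|g dg A]; rewrite /eval !mevalM.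
  by rewrite -!/(eval _ _) f1l // f2l.
by rewrite -!/(eval _ _) f1r // f2r.
Qed.

Lemma inRSLZ c f : inRSL f -> inRSL (c *: f).
Proof.
move=> [fl fr]; split=> [g g' dg dg' A|g dg A]; rewrite /eval !mevalZ.
  by rewrite -!/(eval _ _) fl.
by rewrite -!/(eval _ _) fr.
Qed.

Lemma eval_H_slice a b c : eval H (slice a b c) = 2 / 3 * a.
Proof. by rewrite eval_H_tri eval_h1 /H_form /pol3 /shift3 !mx3E; field. Qed.

Lemma eval_Q_slice a b c : eval Q (slice a b c) = - (1 / 2) * b.
Proof. by rewrite eval_Q_tri eval_h1 eval_q1 /Q_form /pol3 /shift3 !mx3E; field. Qed.

Lemma mx3_congr (a b c d e f g h i a' b' c' d' e' f' g' h' i' : rat) :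
  a = a' -> b = b' -> c = c' -> d = d' -> e = e' -> f = f' -> g = g' -> h = h' ->
  i = i' -> mx3 a b c d e f g h i = mx3 a' b' c' d' e' f' g' h' i'.
Proof. by do 9!move=> ->. Qed.

(** With the scalar 2, the diagonal matrices 2^(3,0,-3) on the left, 2^(-3,0,3)
    on the right and 2^(-1,-4,5) for the mixing multiply each entry by 2 to the
    power of its weight.  All three have determinant 1, so that f only sees the
    scalar. *)
Lemma eval_slice_scaling d f a b c : inRSL f -> f \is d.-homog ->
  eval f (slice (2 ^+ 6 * a) (2 ^+ 9 * b) (2 ^+ 12 * c)) =
  2 ^+ d * eval f (slice a b c).
Proof.
move=> [fl fr] fd.
pose g : 'M[rat]_3 := mx3 8 0 0 0 1 0 0 0 8^-1.
pose g' : 'M[rat]_3 := mx3 8^-1 0 0 0 1 0 0 0 8.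
pose t : 'M[rat]_3 := mx3 2^-1 0 0 0 16^-1 0 0 0 32.
have dg : \det g = 1 by rewrite det_mx3; field.
have dg' : \det (invmx g') = 1 by rewrite det_inv det_mx3; field.
have dt : \det t = 1 by rewrite det_mx3; field.
have e1 := fl g (invmx g') dg dg' (slice a b c); rewrite (invmxK g') in e1.
have e2 := fr t dt (fun k => g *m slice a b c k *m g').
transitivity (2 ^+ d * eval f (ract (fun k => g *m slice a b c k *m g') t));
  last by congr (_ * _); exact: etrans e2 e1.
apply: (etrans _ (dhomog_eval _ _ fd)); apply: eval_ext => k.
rewrite ract_mx3; move: k; apply: forall_I3; rewrite /slice /= /shift3 !mx3E.
- by apply: mx3_congr; lra.
- by apply: mx3_congr; lra.
- by apply: mx3_congr; lra.
Qed.

Lemma map_mx3 (R S : comNzRingType) (u : {rmorphism R -> S}) a b c d e f g h i :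
  map_mx u (mx3 a b c d e f g h i) =
  mx3 (u a) (u b) (u c) (u d) (u e) (u f) (u g) (u h) (u i).
Proof. by apply: mx3P; split; rewrite !mxE. Qed.

Definition slice_poly f : {mpoly rat[3]} := subst_mx f (fun k =>
  nth 0 [:: 1%:M; mx3 0 1 0 0 0 1 0 0 0; mx3 0 'X_1 'X_2 0 'X_0 0 1 0 0] k).

Lemma meval_slice_poly f x : (slice_poly f).@[x] = eval f (slice (x 0) (x 1) (x 2)).
Proof.
rewrite meval_subst_mx; apply: eval_ext; apply: forall_I3 => /=.
- by rewrite map_mx1.
- by rewrite map_mx3 !rmorph0 !rmorph1.
- by rewrite map_mx3 /= !mevalXU !rmorph0 !rmorph1.
Qed.

Lemma slice_poly_weight d f m : inRSL f -> f \is d.-homog ->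
  (slice_poly f)@_m != 0 -> (6 * m 0%R + 9 * m 1%R + 12 * m 2%R)%N = d.
Proof.
move=> fG fd; pose w (i : 'I_3) : rat := nth 0 [:: 2 ^+ 6; 2 ^+ 9; 2 ^+ 12] i.
have scal x : (slice_poly f).@[fun i => w i * x i] = 2 ^+ d * (slice_poly f).@[x].
  rewrite (meval_slice_poly f x) (meval_slice_poly f (fun i => w i * x i)).
  exact: eval_slice_scaling.
move=> /(mcoeff_scaling scal); rewrite prod3E /w /= => e; apply: expr2_inj.
by rewrite -e -!exprM -!exprD.
Qed.

Lemma slice_poly_linear d f i : inRSL f -> f \is d.-homog ->
  (forall m : 'X_{1..3},
     (6 * m 0%R + 9 * m 1%R + 12 * m 2%R)%N = d -> m = U_(i)%MM) ->
  exists k, forall x, (slice_poly f).@[x] = k * x i.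
Proof.
move=> fG fd wd; exists (slice_poly f)@_U_(i) => x.
rewrite (@meval_seq _ _ _ _ [:: U_(i)%MM]) // => [|m fm _]; last first.
  by rewrite inE (wd m (slice_poly_weight fG fd fm)).
by rewrite big_seq1; congr (_ * _); rewrite -[RHS](mevalXU x) mevalX.
Qed.

(** If the only monomial of weight d in a, b, c is one of these variables, the
    restriction to the slice embeds the invariants of degree d into a line. *)
Lemma spans_RSL_slice d i F : inRSL F -> F \is d.-homog ->
  (forall m : 'X_{1..3},
     (6 * m 0%R + 9 * m 1%R + 12 * m 2%R)%N = d -> m = U_(i)%MM) ->
  (exists2 k, k != 0 & forall x : 'I_3 -> rat,
     eval F (slice (x 0) (x 1) (x 2)) = k * x i) ->
  spans_RSL d F.
Proof.
move=> FG Fd wd [k k0 Fk]; split.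
  apply/eqP => F0; have := Fk (fun=> 1); rewrite F0 /eval meval0 mulr1 => k00.
  by rewrite -k00 eqxx in k0.
move=> f; split=> [[fd fG]|[c ->]]; last first.
  by split; [apply: dhomogZ|apply: inRSLZ].
have [l fl] := slice_poly_linear fG fd wd; exists (l / k).
apply/eqP; rewrite -subr_eq0 -scaleNr; apply/eqP; apply: slice_determines.
  by apply: inRSLD fG _; apply: inRSLZ.
move=> a b c; pose x (j : 'I_3) := nth 0 [:: a; b; c] j.
rewrite /eval mevalD mevalZ -!/(eval _ _) (Fk x) -[eval f _](meval_slice_poly f x).
by rewrite fl mulNr mulrA divfK // subrr.
Qed.

Lemma mnm3_eqU (m : 'X_{1..3}) (i : 'I_3) :
  m 0 = (i == 0) -> m 1 = (i == 1) -> m 2 = (i == 2) -> m = U_(i)%MM.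
Proof. by move=> m0 m1 m2; apply/mnmP; apply: forall_I3; rewrite mnm1E. Qed.

Lemma spans_RSL_H : spans_RSL 6 H.
Proof.
apply: (@spans_RSL_slice _ 0 _ inRSL_H (rel_inv_dhomog rel_inv_H)).
- by move=> m e; apply: mnm3_eqU => /=; lia.
- by exists (2 / 3) => // x; rewrite eval_H_slice.
Qed.

Lemma spans_RSL_Q : spans_RSL 9 Q.
Proof.
apply: (@spans_RSL_slice _ 1 _ inRSL_Q (rel_inv_dhomog rel_inv_Q)).
- by move=> m e; apply: mnm3_eqU => /=; lia.
- by exists (- (1 / 2)) => // x; rewrite eval_Q_slice.
Qed.

(** * The Aronhold invariants of a Weierstrass cubic *)

Lemma forall_I10 (P : 'I_10 -> Prop) : P 0 -> P 1 -> P 2 -> P 3 -> P 4 -> P 5 ->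
  P 6 -> P 7 -> P 8 -> P 9 -> forall i, P i.
Proof.
move=> p0 p1 p2 p3 p4 p5 p6 p7 p8 p9 [[|[|[|[|[|[|[|[|[|[|//]]]]]]]]]] lt];
  [move: p0|move: p1|move: p2|move: p3|move: p4|move: p5|move: p6|move: p7
  |move: p8|move: p9]; by congr P; apply: val_inj.
Qed.

Lemma sum10E (V : nmodType) (F : 'I_10 -> V) :
  \sum_i F i = F 0 + F 1 + F 2 + F 3 + F 4 + F 5 + F 6 + F 7 + F 8 + F 9.
Proof.
rewrite !big_ord_recl big_ord0 addr0 !addrA.
by do ![congr (_ + _)]; congr F; apply: val_inj.
Qed.

Lemma prod10E (R : comNzRingType) (F : 'I_10 -> R) :
  \prod_i F i = F 0 * F 1 * F 2 * F 3 * F 4 * F 5 * F 6 * F 7 * F 8 * F 9.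
Proof.
rewrite !big_ord_recl big_ord0 mulr1 !mulrA.
by do ![congr (_ * _)]; congr F; apply: val_inj.
Qed.

Lemma meval_ternary_cubic u x : (ternary_cubic u).@[x] =
  u 0 * x 0 ^+ 3 + u 1 * x 1 ^+ 3 + u 2 * x 2 ^+ 3
  + 3 * u 3 * (x 0 ^+ 2 * x 1) + 3 * u 4 * (x 0 ^+ 2 * x 2)
  + 3 * u 5 * (x 0 * x 1 ^+ 2) + 3 * u 6 * (x 1 ^+ 2 * x 2)
  + 3 * u 7 * (x 0 * x 2 ^+ 2) + 3 * u 8 * (x 1 * x 2 ^+ 2)
  + 6 * u 9 * (x 0 * x 1 * x 2).
Proof.
rewrite /ternary_cubic !(mevalD, mevalZ).
by rewrite !(mevalM, rmorphXn) /= !mevalXU.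
Qed.

Lemma cubic_invariant_eq P g u v : cubic_invariant P -> \det g = 1 ->
  (forall x, (ternary_cubic v).@[x] =
     (ternary_cubic u).@[fun i => \sum_(j < 3) g i j * x j]) ->
  P.@[v] = P.@[u].
Proof.
move=> Pinv dg uv; apply: (Pinv g dg); apply: meval_inj => x.
rewrite uv comp_mpoly_meval; apply: meval_eq => i.
rewrite tnth_mktuple raddf_sum; apply: eq_bigr => j _.
by rewrite /= mevalZ mevalXU.
Qed.

(** The exponent of the v-th variable in the monomial of the general cubic whose
    coefficient has index i. *)
Definition exponents (v : 'I_3) (i : 'I_10) : nat :=
  nth 0%N (nth [::] [:: [:: 3; 0; 0; 2; 2; 1; 0; 1; 0; 1];
                        [:: 0; 3; 0; 1; 0; 2; 2; 0; 1; 1];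
                        [:: 0; 0; 3; 0; 1; 0; 1; 2; 2; 1]] v) i.

Lemma cubic_torus P (s : 'I_3 -> rat) x : cubic_invariant P -> s 0 * s 1 * s 2 = 1 ->
  P.@[fun i => (\prod_v s v ^+ exponents v i) * x i] = P.@[x].
Proof.
move=> Pinv s1; apply: (@cubic_invariant_eq P (mx3 (s 0) 0 0 0 (s 1) 0 0 0 (s 2))) => //.
  by rewrite det_mx3 -s1; ring.
move=> y; rewrite !meval_ternary_cubic !sum3E !mxE /= !prod3E /exponents /=.
by ring.
Qed.

Definition multidegree (v : 'I_3) (m : 'X_{1..10}) := (\sum_i exponents v i * m i)%N.

Lemma cubic_scaling P (s : 'I_3 -> rat) m : cubic_invariant P ->
  s 0 * s 1 * s 2 = 1 -> P@_m != 0 -> \prod_v s v ^+ multidegree v m = 1.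
Proof.
move=> Pinv s1 Pm.
have scal x : P.@[fun i => (\prod_v s v ^+ exponents v i) * x i] = 1 * P.@[x].
  by rewrite mul1r; apply: cubic_torus.
apply: (etrans _ (mcoeff_scaling scal Pm)).
under eq_bigr => v _ do rewrite /multidegree -prodrXr.
rewrite exchange_big; apply: eq_bigr => i _ /=; rewrite -prodrXl.
by apply: eq_bigr => v _; rewrite exprM.
Qed.

(** The torus elements diag(2, 1/2, 1) and diag(1, 2, 1/2) suffice. *)
Lemma multidegree_eq P m : cubic_invariant P -> P@_m != 0 ->
  multidegree 0 m = multidegree 1 m /\ multidegree 1 m = multidegree 2 m.
Proof.
move=> Pinv Pm; split; apply: expr2_inj.
  pose s (v : 'I_3) : rat := nth 0 [:: 2; 2^-1; 1] v.
  have s1 : s 0 * s 1 * s 2 = 1 by rewrite /s /=; field.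
  have := cubic_scaling Pinv s1 Pm; rewrite prod3E /s /= expr1n mulr1 exprVn => e.
  by rewrite -[LHS](divfK (expf_neq0 (multidegree 1 m) (_ : 2 != 0))) // e mul1r.
pose s (v : 'I_3) : rat := nth 0 [:: 1; 2; 2^-1] v.
have s1 : s 0 * s 1 * s 2 = 1 by rewrite /s /=; field.
have := cubic_scaling Pinv s1 Pm; rewrite prod3E /s /= expr1n mul1r exprVn => e.
by rewrite -[LHS](divfK (expf_neq0 (multidegree 2 m) (_ : 2 != 0))) // e mul1r.
Qed.

Lemma cubic_monomial d P (u : 'I_10 -> rat) m :
  cubic_invariant P -> P \is d.-homog -> P@_m != 0 -> \prod_i u i ^+ m i != 0 ->
  [/\ forall i, u i = 0 -> m i = 0%N, (\sum_i m i)%N = d,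
     multidegree 0 m = multidegree 1 m & multidegree 1 m = multidegree 2 m].
Proof.
move=> Pinv Pd Pm um; have [e1 e2] := multidegree_eq Pinv Pm; split=> // [i ui|].
  have := um; rewrite (bigD1 i) //= mulf_eq0 negb_or ui expr0n => /andP [+ _].
  by case: (m i) => //=; rewrite eqxx.
by rewrite -mdegE; apply: (dhomog_mf Pd); rewrite mcoeff_msupp.
Qed.

(** a X^3 + c Z^3 + 3 b3 Y^2 Z + 3 c1 X Z^2 *)
Definition weierstrass (a c b3 c1 : rat) (i : 'I_10) : rat :=
  nth 0 [:: a; 0; c; 0; 0; 0; b3; c1; 0; 0] i.

(** a X^3 + b Y^3 + c Z^3 + 6 m XYZ *)
Definition hesse (a b c m : rat) (i : 'I_10) : rat :=
  nth 0 [:: a; b; c; 0; 0; 0; 0; 0; 0; m] i.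

Lemma mnm10P (m : 'X_{1..10}) a0 a1 a2 a3 a4 a5 a6 a7 a8 a9 :
  [/\ m 0 = a0, m 1 = a1, m 2 = a2, m 3 = a3 & m 4 = a4] ->
  [/\ m 5 = a5, m 6 = a6, m 7 = a7, m 8 = a8 & m 9 = a9] ->
  m = [multinom [tuple a0; a1; a2; a3; a4; a5; a6; a7; a8; a9]].
Proof. by case=> ? ? ? ? ? [? ? ? ? ?]; apply/mnmP; apply: forall_I10. Qed.

Lemma weierstrass_monomial d P a c b3 c1 (m : 'X_{1..10}) :
  cubic_invariant P -> P \is d.-homog -> P@_m != 0 ->
  \prod_i weierstrass a c b3 c1 i ^+ m i != 0 ->
  [/\ m 1%R = 0, m 3%R = 0, m 4%R = 0, m 5%R = 0 & m 8%R = 0]%N /\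
  [/\ m 9%R = 0, m 0%R + m 2%R + m 6%R + m 7%R = d, 3 * m 0%R + m 7%R = 2 * m 6%R &
      2 * m 6%R = 3 * m 2%R + m 6%R + 2 * m 7%R]%N.
Proof.
move=> Pinv Pd Pm um; have [u0] := cubic_monomial Pinv Pd Pm um.
rewrite /multidegree !sum10E /exponents /=.
have -> := u0 1 erefl; have -> := u0 3 erefl; have -> := u0 4 erefl.
have -> := u0 5 erefl; have -> := u0 8 erefl; have -> := u0 9 erefl.
by move=> e1 e2 e3; split; split=> //; lia.
Qed.

Lemma hesse_monomial d P a b c n (m : 'X_{1..10}) :
  cubic_invariant P -> P \is d.-homog -> P@_m != 0 ->
  \prod_i hesse a b c n i ^+ m i != 0 ->
  [/\ m 3%R = 0, m 4%R = 0, m 5%R = 0, m 6%R = 0 & m 7%R = 0]%N /\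
  [/\ m 8%R = 0, m 0%R + m 1%R + m 2%R + m 9%R = d, m 0%R = m 1%R & m 1%R = m 2%R]%N.
Proof.
move=> Pinv Pd Pm um; have [u0] := cubic_monomial Pinv Pd Pm um.
rewrite /multidegree !sum10E /exponents /=.
have -> := u0 3 erefl; have -> := u0 4 erefl; have -> := u0 5 erefl.
have -> := u0 6 erefl; have -> := u0 7 erefl; have -> := u0 8 erefl.
by move=> e1 e2 e3; split; split=> //; lia.
Qed.

Section Aronhold.

Variables S T : {mpoly rat[10]}.
Hypotheses (SP : aronhold_S S) (TP : aronhold_T T).

Lemma S_weierstrass_scale :
  exists k, forall a c b3 c1, S.@[weierstrass a c b3 c1] = k * (a * b3 ^+ 2 * c1).
Proof.
have [Sd Sinv _] := SP; pose m0 := [multinom [tuple 1; 0; 0; 0; 0; 0; 2; 1; 0; 0]]%N.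
exists S@_m0 => a c b3 c1; rewrite (@meval_seq _ _ _ _ [:: m0]) // => [|m Sm um].
  rewrite big_seq1 prod10E /weierstrass /=; ring.
have [[? ? ? ? ?] [? ? ? ?]] := weierstrass_monomial Sinv Sd Sm um.
by rewrite inE; apply/eqP; apply: mnm10P; split; lia.
Qed.

Lemma T_weierstrass_scale :
  exists k, forall a c b3 c1, T.@[weierstrass a c b3 c1] = k * (a ^+ 2 * c * b3 ^+ 3).
Proof.
have [Td Tinv _] := TP; pose m0 := [multinom [tuple 2; 0; 1; 0; 0; 0; 3; 0; 0; 0]]%N.
exists T@_m0 => a c b3 c1; rewrite (@meval_seq _ _ _ _ [:: m0]) // => [|m Tm um].
  rewrite big_seq1 prod10E /weierstrass /=; ring.
have [[? ? ? ? ?] [? ? ? ?]] := weierstrass_monomial Tinv Td Tm um.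
by rewrite inE; apply/eqP; apply: mnm10P; split; lia.
Qed.

Lemma S_hesse : exists k, forall a b c m,
  S.@[hesse a b c m] = a * b * c * m + k * m ^+ 4.
Proof.
have [Sd Sinv S1] := SP; pose m0 := [multinom [tuple 1; 1; 1; 0; 0; 0; 0; 0; 0; 1]]%N.
pose m1 := [multinom [tuple 0; 0; 0; 0; 0; 0; 0; 0; 0; 4]]%N.
exists S@_m1 => a b c n; rewrite (@meval_seq _ _ _ _ [:: m0; m1]) // => [|m Sm um].
  rewrite !big_cons big_nil S1 !prod10E /hesse /=; ring.
have [[? ? ? ? ?] [? ? ? ?]] := hesse_monomial Sinv Sd Sm um.
rewrite !inE; have [m9|m9] : (m 9%R = 1 \/ m 9%R = 4)%N by lia.
  by apply/orP; left; apply/eqP; apply: mnm10P; split; lia.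
by apply/orP; right; apply/eqP; apply: mnm10P; split; lia.
Qed.

Lemma T_hesse : exists k l, forall a b c m,
  T.@[hesse a b c m] = (a * b * c) ^+ 2 + k * (a * b * c * m ^+ 3) + l * m ^+ 6.
Proof.
have [Td Tinv T1] := TP; pose m0 := [multinom [tuple 2; 2; 2; 0; 0; 0; 0; 0; 0; 0]]%N.
pose m1 := [multinom [tuple 1; 1; 1; 0; 0; 0; 0; 0; 0; 3]]%N.
pose m2 := [multinom [tuple 0; 0; 0; 0; 0; 0; 0; 0; 0; 6]]%N.
exists T@_m1, T@_m2 => a b c n.
rewrite (@meval_seq _ _ _ _ [:: m0; m1; m2]) // => [|m Tm um].
  rewrite !big_cons big_nil T1 !prod10E /hesse /=; ring.
have [[? ? ? ? ?] [? ? ? ?]] := hesse_monomial Tinv Td Tm um.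
rewrite !inE; have [m9|[m9|m9]] : (m 9%R = 0 \/ m 9%R = 3 \/ m 9%R = 6)%N by lia.
- by apply/orP; left; apply/eqP; apply: mnm10P; split; lia.
- by apply/orP; right; apply/orP; left; apply/eqP; apply: mnm10P; split; lia.
- by apply/orP; right; apply/orP; right; apply/eqP; apply: mnm10P; split; lia.
Qed.

(** Move the flex (1 : -1 : 0) of X^3 + Y^3 + t Z^3 + 6XYZ to (0 : 1 : 0) and
    its tangent X + Y - 2Z = 0 to Z = 0, by X = x - y/2, Y = x + y/2, Z = x + z.
    The shift of x by s z which is then applied removes the term x^2 z; this is
    the condition on s. *)
Lemma hesse_weierstrass P t s : cubic_invariant P -> (8 + t) * s = 2 + t ->
  P.@[hesse 1 1 t 1] = P.@[weierstrass (8 + t)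
    (t - 3 * t * s + 3 * (2 + t) * s ^+ 2 - (8 + t) * s ^+ 3) (- (1 / 2))
    (t - (2 + t) * s)].
Proof.
move=> Pinv st; apply/esym.
apply: (@cubic_invariant_eq P
  (mx3 1 (- (1 / 2)) (- s) 1 (1 / 2) (- s) 1 0 (1 - s))) => //.
  by rewrite det_mx3; field.
move=> x; rewrite !meval_ternary_cubic !sum3E !mxE /= /hesse /weierstrass /=.
apply/eqP; rewrite -subr_eq0; apply/eqP.
transitivity (((8 + t) * s - (2 + t)) *
  (3 * x 0 ^+ 2 * x 2 - 3 * s * x 0 * x 2 ^+ 2)).
  by field.
by rewrite st subrr mul0r.
Qed.

(** Two of the Hesse cubics, t = -2 and t = 0, determine both the coefficient of
    m^4 in S and the scalar. *)
Lemma S_weierstrass a c b3 c1 : S.@[weierstrass a c b3 c1] = a * b3 ^+ 2 * c1.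
Proof.
have [_ Sinv _] := SP; have [k Sw] := S_weierstrass_scale; have [l Sh] := S_hesse.
have e1 : -2 + l = - 3 * k.
  have := @hesse_weierstrass S (-2) 0 Sinv; rewrite Sh Sw; lra.
have e2 : l = - k.
  have := @hesse_weierstrass S 0 (1 / 4) Sinv; rewrite Sh Sw; lra.
by rewrite Sw -[RHS]mul1r; congr (_ * _); lra.
Qed.

(** Three unknowns remain, the coefficients of abcm^3 and m^6 and the scalar, so
    that a third Hesse cubic is used. *)
Lemma T_weierstrass a c b3 c1 : T.@[weierstrass a c b3 c1] = 4 * (a ^+ 2 * c * b3 ^+ 3).
Proof.
have [_ Tinv _] := TP; have [k Tw] := T_weierstrass_scale; have [l [n Th]] := T_hesse.
have e1 : 4 - 2 * l + n = 9 * k.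
  have := @hesse_weierstrass T (-2) 0 Tinv; rewrite Th Tw; lra.
have e2 : n = - 2 * k.
  have := @hesse_weierstrass T 0 (1 / 4) Tinv; rewrite Th Tw; lra.
have e3 : 1 + l + n = - (27 / 4) * k.
  have := @hesse_weierstrass T 1 (1 / 3) Tinv; rewrite Th Tw; lra.
by rewrite Tw; congr (_ * _); lra.
Qed.

End Aronhold.

(** * The cubic of a triple *)

Definition net_coefs (A : triple) (i : 'I_10) : rat :=
  nth 0 [:: \det (A 0); \det (A 1); \det (A 2);
    3^-1 * pol (A 0) (A 1); 3^-1 * pol (A 0) (A 2); 3^-1 * pol (A 1) (A 0);
    3^-1 * pol (A 1) (A 2); 3^-1 * pol (A 2) (A 0); 3^-1 * pol (A 2) (A 1);
    6^-1 * pol3 (A 0) (A 1) (A 2)] i.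

Lemma meval_net_coefs A x :
  (ternary_cubic (net_coefs A)).@[x] = \det (\sum_i x i *: A i).
Proof.
by rewrite meval_ternary_cubic sum3E det_net /net_coefs /=; field.
Qed.

Lemma eval_subst_f P A : eval (subst_f P) A = P.@[net_coefs A].
Proof.
have gen (p0 p1 p2 p3 p4 p5 p6 p7 p8 p9 : polyfun) d0 d1 d2 d3 d4 d5 d6 d7 d8 d9 :
    eval p0 A = d0 -> eval p1 A = d1 -> eval p2 A = d2 -> eval p3 A = d3 ->
    eval p4 A = d4 -> eval p5 A = d5 -> eval p6 A = d6 -> eval p7 A = d7 ->
    eval p8 A = d8 -> eval p9 A = d9 ->
    eval (P \mPo [tuple p0; p1; p2; 3^-1 *: p3; 3^-1 *: p4; 3^-1 *: p5; 3^-1 *: p6;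
                  3^-1 *: p7; 3^-1 *: p8; 6^-1 *: p9]) A =
    P.@[fun i => nth 0 [:: d0; d1; d2; 3^-1 * d3; 3^-1 * d4; 3^-1 * d5; 3^-1 * d6;
      3^-1 * d7; 3^-1 * d8; 6^-1 * d9] i].
  do 10!move=> <-; rewrite /eval comp_mpoly_meval; apply: meval_eq.
  by apply: forall_I10; rewrite (tnth_nth 0) /= ?mevalZ.
have [[? ? ?] [? ? ? ?] [? ? ?]] := eval_fE A; exact: gen.
Qed.

(** The mixing action on triples is a linear substitution in the cubic
    det (x A_0 + y A_1 + z A_2), and the other two factors do not change it. *)
Lemma inRSL_subst_f P : cubic_invariant P -> inRSL (subst_f P).
Proof.
move=> Pinv; split=> [g g' dg dg' A|g dg A]; rewrite !eval_subst_f.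
  apply: (@cubic_invariant_eq P 1%:M); rewrite ?det1 // => x.
  rewrite !meval_net_coefs.
  have -> : \sum_i x i *: (g *m A i *m invmx g') =
      g *m (\sum_i x i *: A i) *m invmx g'.
    rewrite mulmx_sumr mulmx_suml; apply: eq_bigr => i _.
    by rewrite -scalemxAr -scalemxAl.
  rewrite !det_mulmx det_inv dg dg' invr1 mul1r mulr1; congr (\det _).
  apply: eq_bigr => i _; congr (_ *: _).
  rewrite (bigD1 i) //= mxE eqxx mul1r big1 ?addr0 // => j /negPf ji.
  by rewrite mxE eq_sym ji mul0r.
apply: (@cubic_invariant_eq P g) => // x; rewrite !meval_net_coefs.
congr (\det _); rewrite /ract; under eq_bigr => j _ do rewrite scaler_sumr.
rewrite exchange_big; apply: eq_bigr => i _ /=; rewrite scaler_suml.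
by apply: eq_bigr => j _; rewrite scalerA mulrC.
Qed.

(** On the slice the cubic is
    x^3 + a x^2 z + y^2 z + b y z^2 - c x z^2 - a c z^3; complete the cube and
    the square. *)
Lemma net_coefs_slice P a b c : cubic_invariant P ->
  P.@[net_coefs (slice a b c)] =
  P.@[weierstrass 1 (2 / 27 * a ^+ 3 - 2 / 3 * (a * c) - b ^+ 2 / 4) (1 / 3)
        (- (a ^+ 2 / 3 + c) / 3)].
Proof.
move=> Pinv; apply/esym.
apply: (@cubic_invariant_eq P (mx3 1 0 (- (a / 3)) 0 1 (- (b / 2)) 0 0 1)) => //.
  by rewrite det_mx3; field.
move=> x; rewrite meval_net_coefs meval_ternary_cubic !sum3E !mxE /weierstrass.
by rewrite /slice /= /shift3 !mx3E; field.
Qed.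

Lemma subst_f_slice S T a b c : aronhold_S S -> aronhold_T T ->
  eval (subst_f S) (slice a b c) = - (a ^+ 2 / 3 + c) / 27 /\
  eval (subst_f T) (slice a b c) =
    4 / 27 * (2 / 27 * a ^+ 3 - 2 / 3 * (a * c) - b ^+ 2 / 4).
Proof.
move=> SP TP; have [_ Sinv _] := SP; have [_ Tinv _] := TP.
rewrite !eval_subst_f !net_coefs_slice // S_weierstrass // T_weierstrass //.
by split; field.
Qed.

Theorem theorem1 :
  (forall S T : {mpoly rat[10]}, aronhold_S S -> aronhold_T T ->
     Q ^+ 2 = H ^+ 3 + 27 *: (H * subst_f S) - (27 / 4) *: subst_f T)
  /\ spans_RSL 6 H /\ spans_RSL 9 Q.
Proof.
split; last by split; [exact: spans_RSL_H|exact: spans_RSL_Q].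
move=> S T SP TP; have [_ Sinv _] := SP; have [_ Tinv _] := TP.
have HG := inRSL_H; have QG := inRSL_Q.
have SG := inRSL_subst_f Sinv; have TG := inRSL_subst_f Tinv.
apply/eqP; rewrite -subr_eq0; apply/eqP.
have -> : Q ^+ 2 - (H ^+ 3 + 27 *: (H * subst_f S) - (27 / 4) *: subst_f T) =
    Q * Q + ((-1) *: (H * H * H) +
             ((-27) *: (H * subst_f S) + (27 / 4) *: subst_f T)).
  move: (subst_f S) (subst_f T) H Q => s t u v.
  by rewrite scaleN1r scaleNr; ring.
apply: slice_determines => [|a b c].
  apply: inRSLD (inRSLM QG QG) (inRSLD (inRSLZ _ (inRSLM (inRSLM HG HG) HG)) _).
  exact: inRSLD (inRSLZ _ (inRSLM HG SG)) (inRSLZ _ TG).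
have [Sv Tv] := subst_f_slice a b c SP TP.
have gen (s t u v : polyfun) A s0 t0 u0 v0 :
    eval s A = s0 -> eval t A = t0 -> eval u A = u0 -> eval v A = v0 ->
    eval (v * v + ((-1) *: (u * u * u) + ((-27) *: (u * s) + (27 / 4) *: t))) A =
    v0 ^+ 2 + (- u0 ^+ 3 + (- 27 * (u0 * s0) + 27 / 4 * t0)).
  by do 4!move=> <-; rewrite /eval !(mevalD, mevalZ, mevalM); ring.
rewrite (gen _ _ _ _ _ _ _ _ _ Sv Tv (eval_H_slice a b c) (eval_Q_slice a b c)).
by field.
Qed.
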